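(* Let $\Delta$ and $\Gamma$ be finite simplicial graphs with $n=|V(\Delta)|$. If $\mathrm{Th}_\exists(\mathbb{G}(\Delta))\subseteq\mathrm{Th}_\exists(\mathbb{G}(\Gamma))$, then there exists a tame embedding $\varphi:\mathbb{G}(\Delta)\to\mathbb{G}(\Gamma_n)$.
   Context: $\mathbb{G}(\Gamma)=\langle V(\Gamma)\mid [x,y]=1 \text{ for } (x,y)\in E(\Gamma)\rangle$. $\mathrm{Th}_\exists(G)$ is the set of existential sentences in the language of groups true in $G$. The $n$-inflation $\Gamma_n$ has vertices $v_1,\dots,v_n$ for each $v\in V(\Gamma)$; $v_i,v_j$ adjacent for $i\ne j$, and $v_i,w_k$ ($v\ne w$) adjacent iff $(v,w)\in E(\Gamma)$. An embedding $\varphi:\mathbb{G}(\Delta)\to\mathbb{G}(\Lambda)$ is tame if for each $x_i\in V(\Delta)$, $\varphi(x_i)=y_{i1}\cdots y_{ir_i}$ where $y_{ij}=g_{ij}^{-1}x_{ij}'^{\,n_{ij}}g_{ij}$ with $x'_{ij}\in V(\Lambda)$, $n_{ij}\in\mathbb{Z}$, $g_{ij}\in\mathbb{G}(\Lambda)$, the $y_{i1},\dots,y_{ir_i}$ pairwise commute, and the conjugates $g_{ij}^{-1}x'_{ij}g_{ij}$ are pairwise distinct over all pairs $(i,j)$. *)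

(* Defs.v *)
From mathcomp Require Import all_boot ssralg ssrnum ssrint.
Set Implicit Arguments. Unset Strict Implicit. Unset Printing Implicit Defensive.

Definition simplicial_graph (V : finType) (E : rel V) : Prop :=
  symmetric E /\ irreflexive E.

Section RAAG.
Variable V : eqType.
Variable E : rel V.

(* a letter (v, b) stands for v if b = false and v^-1 if b = true *)
Definition letter := (V * bool)%type.
Definition word := seq letter.

(* defining relations of G(E) = < V | [x,y] = 1 for (x,y) in E > on words *)
Inductive rstep : word -> word -> Prop :=
| rs_free v b : rstep [:: (v, b); (v, ~~ b)] [::]
| rs_comm v w : E v w -> rstep [:: (v, false); (w, false)] [:: (w, false); (v, false)].

Inductive raag_eq : word -> word -> Prop :=
| re_step u s t w : rstep s t -> raag_eq (u ++ s ++ w) (u ++ t ++ w)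
| re_refl u : raag_eq u u
| re_sym u w : raag_eq u w -> raag_eq w u
| re_trans u w z : raag_eq u w -> raag_eq w z -> raag_eq u z.

(* group operations: product = concatenation, unit = empty word *)
Definition winv (u : word) : word := rev [seq (l.1, ~~ l.2) | l <- u].
End RAAG.

Inductive gterm : Type :=
| TVar of nat | TOne | TMul of gterm & gterm | TInv of gterm.

Inductive qformula : Type :=
| QEq of gterm & gterm
| QTrue | QFalse
| QNot of qformula
| QAnd of qformula & qformula
| QOr of qformula & qformula.

Section Semantics.
Variable V : eqType.
Variable E : rel V.

Fixpoint teval (env : nat -> word V) (t : gterm) : word V :=
  match t with
  | TVar i => env i
  | TOne => [::]
  | TMul a b => teval env a ++ teval env b
  | TInv a => winv (teval env a)
  end.

Fixpoint qsat (env : nat -> word V) (f : qformula) : Prop :=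
  match f with
  | QEq a b => raag_eq E (teval env a) (teval env b)
  | QTrue => True
  | QFalse => False
  | QNot g => ~ qsat env g
  | QAnd g h => qsat env g /\ qsat env h
  | QOr g h => qsat env g \/ qsat env h
  end.

(* the existential sentence "exists x_0 ... x_k, f" (existential closure of
   the quantifier-free formula f) holds in G(E) *)
Definition ex_holds (f : qformula) : Prop := exists env : nat -> word V, qsat env f.
End Semantics.

Definition th_ex_sub (V1 V2 : eqType) (E1 : rel V1) (E2 : rel V2) : Prop :=
  forall f : qformula, ex_holds E1 f -> ex_holds E2 f.

Definition inflation (V : finType) (E : rel V) (n : nat) : rel (V * 'I_n)%type :=
  fun p q => if p.1 == q.1 then p.2 != q.2 else E p.1 q.1.

Section Embeddings.
Variables (VD : eqType) (ED : rel VD) (VL : eqType) (EL : rel VL).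

Definition extend (phi : VD -> word VL) (u : word VD) : word VL :=
  flatten [seq (if l.2 then winv (phi l.1) else phi l.1) | l <- u].

Definition is_hom (phi : VD -> word VL) : Prop :=
  forall x y, ED x y -> raag_eq EL (phi x ++ phi y) (phi y ++ phi x).

Definition is_injective_hom (phi : VD -> word VL) : Prop :=
  forall u w, raag_eq EL (extend phi u) (extend phi w) -> raag_eq ED u w.

Definition wpow (v : VL) (k : int) : word VL := nseq `|k|%N (v, (k < 0)%R).
Definition conjw (g w : word VL) : word VL := winv g ++ w ++ g.
(* the datum (g, x', k) represents y = g^-1 x'^k g *)
Definition yword (d : word VL * VL * int) : word VL := conjw d.1.1 (wpow d.1.2 d.2).
Definition cword (d : word VL * VL * int) : word VL := conjw d.1.1 [:: (d.1.2, false)].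

Definition is_tame (phi : VD -> word VL) : Prop :=
  exists dat : VD -> seq (word VL * VL * int),
    [/\ forall x, raag_eq EL (phi x) (flatten [seq yword d | d <- dat x]),
        forall x (j1 j2 : 'I_(size (dat x))),
          raag_eq EL (yword (tnth (in_tuple (dat x)) j1) ++ yword (tnth (in_tuple (dat x)) j2))
                     (yword (tnth (in_tuple (dat x)) j2) ++ yword (tnth (in_tuple (dat x)) j1))
      & forall x1 x2 (j1 : 'I_(size (dat x1))) (j2 : 'I_(size (dat x2))),
          (x1 <> x2 \/ nat_of_ord j1 <> nat_of_ord j2) ->
          ~ raag_eq EL (cword (tnth (in_tuple (dat x1)) j1))
                       (cword (tnth (in_tuple (dat x2)) j2))].

Definition tame_embedding (phi : VD -> word VL) : Prop :=
  [/\ is_hom phi, is_injective_hom phi & is_tame phi].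
End Embeddings.

(* Main.v *)
(* An inclusion of existential theories provides, for any finite set of nontrivial
   elements of G(ED), a homomorphism psi to G(EG) that kills none of them. Write
   psi(x) as a commuting product of blocks: conjugates of cyclically reduced
   elements whose support is connected in the complement graph. Then psi factors
   as G(ED) -> G(L) -> G(EG), where L is the commutation graph of the blocks. There
   are finitely many possible maps G(ED) -> G(L), so psi can be chosen to be
   nontrivial on a kernel element of each of the noninjective ones; the map
   G(ED) -> G(L) that comes from psi is then injective.

   It remains to embed G(L) in G(EG_n). Two commuting blocks either have
   parabolic closures that commute elementwise, or have the same parabolic closure
   and a common abelian centralizer in it. In the first case the blocks may be
   replaced by generic conjugates of vertices of their supports without changing
   the commutation graph; the blocks of one class of the second kind are replaced
   by the copies of a single such conjugate in the inflation. Finally, suitable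
   powers of distinct conjugates of vertices generate the right-angled Artin group
   of their commutation graph: passing to an m-fold double of the graph along the
   star of v, the defining graph of a subgroup of index m, removes the letter v
   from the conjugating words.

   The group theory rests on Fox derivatives with values in Z[G/<lk x>]: the
   support of the derivative of a reduced word is the set of x-hyperplanes that it
   crosses, each of them once. *)
From HB Require Import structures.
Require Import Defs.
From mathcomp Require Import all_boot ssralg ssrnum ssrint monoid generic_quotient.
From mathcomp Require Import boolp.
Set Implicit Arguments. Unset Strict Implicit. Unset Printing Implicit Defensive.
Import GRing.Theory Num.Theory.
Local Open Scope group_scope.

(** * Right-angled Artin groups as quotient groups *)

Section Group.
Variables (V : choiceType) (E : rel V).
Implicit Types (u w : word V) (v : V) (l : letter V).

Lemma raag_eq_cat u u' w w' :
  raag_eq E u u' -> raag_eq E w w' -> raag_eq E (u ++ w) (u' ++ w').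
Proof.
have catl a b c : raag_eq E a b -> raag_eq E (c ++ a) (c ++ b).
  elim=> {a b} [a s t b st|a|a b _ IH|a b d _ IH _ IH'].
  - by rewrite !catA -[X in raag_eq _ X _]catA -[X in raag_eq _ _ X]catA; apply: re_step.
  - exact: re_refl.
  - exact: re_sym.
  - exact: re_trans IH IH'.
have catr a b c : raag_eq E a b -> raag_eq E (a ++ c) (b ++ c).
  elim=> {a b} [a s t b st|a|a b _ IH|a b d _ IH _ IH'].
  - by rewrite -!catA; apply: re_step.
  - exact: re_refl.
  - exact: re_sym.
  - exact: re_trans IH IH'.
by move=> uu' ww'; apply: re_trans (catr _ _ w uu') (catl _ _ u' ww').
Qed.

Lemma raag_eq_winvl u : raag_eq E (winv u ++ u) [::].
Proof.
elim: u => [|[v b] u IH]; first exact: re_refl.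
rewrite /winv map_cons rev_cons -cats1 -catA /=.
have := @re_step _ E (winv u) [:: (v, ~~ b); (v, b)] [::] u.
rewrite -{2}[b]negbK => /(_ (rs_free _ _ _)) /re_trans; apply.
by apply: IH.
Qed.

Lemma winvK : involutive (@winv V).
Proof.
by move=> u; rewrite /winv map_rev revK -map_comp map_id_in // => -[v b] _ /=;
  rewrite negbK.
Qed.

Lemma winv_cat u w : winv (u ++ w) = winv w ++ winv u.
Proof. by rewrite /winv map_cat rev_cat. Qed.

Lemma raag_eq_winv u w : raag_eq E u w -> raag_eq E (winv u) (winv w).
Proof.
move=> uw; have r1 : raag_eq E (winv u) (winv u ++ (w ++ winv w)).
  rewrite -{1}[winv u]cats0; apply: raag_eq_cat; first exact: re_refl.
  by apply: re_sym; rewrite -{1}[w]winvK; apply: raag_eq_winvl.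
apply: re_trans r1 _; rewrite catA -{2}[winv w]cat0s.
apply: raag_eq_cat; last exact: re_refl.
apply: re_trans (raag_eq_winvl u).
by apply: raag_eq_cat; [apply: re_refl | apply: re_sym].
Qed.

Definition raag_eqb : rel (word V) := fun u w => `[< raag_eq E u w >].

Lemma raag_eqb_equiv : equiv_class_of raag_eqb.
Proof.
split.
- by move=> u; apply/asboolP; apply: re_refl.
- by move=> u w; apply/asboolP/asboolP; apply: re_sym.
- by move=> u w z /asboolP uw /asboolP wz; apply/asboolP; apply: re_trans uw wz.
Qed.
Canonical raag_equiv := EquivRelPack raag_eqb_equiv.

Definition raag := {eq_quot raag_equiv}%qT.
HB.instance Definition _ := Choice.on raag.

Definition rcl (w : word V) : raag := (\pi_raag w)%qT.
Definition rword (g : raag) : word V := repr g.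

Lemma rwordK : cancel rword rcl.
Proof. exact: reprK. Qed.

Lemma rclP u w : rcl u = rcl w <-> raag_eq E u w.
Proof.
split; first by move=> /eqmodP /asboolP.
by move=> uw; apply/eqmodP/asboolP.
Qed.

Lemma raag_eq_rword w : raag_eq E (rword (rcl w)) w.
Proof. by apply/rclP; rewrite rwordK. Qed.

Definition raag_mul (g h : raag) := rcl (rword g ++ rword h).
Definition raag_inv (g : raag) := rcl (winv (rword g)).
Definition raag_one : raag := rcl [::].

Lemma raag_mulE u w : raag_mul (rcl u) (rcl w) = rcl (u ++ w).
Proof. by apply/rclP/raag_eq_cat; apply: raag_eq_rword. Qed.
Lemma raag_mulA : associative raag_mul.
Proof.
move=> g h k; rewrite -(rwordK g) -(rwordK h) -(rwordK k) !raag_mulE.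
by rewrite catA.
Qed.
Lemma raag_mul1g : left_id raag_one raag_mul.
Proof. by move=> g; rewrite -(rwordK g) raag_mulE. Qed.
Lemma raag_mulg1 : right_id raag_one raag_mul.
Proof. by move=> g; rewrite -(rwordK g) raag_mulE cats0. Qed.
Lemma raag_invE u : raag_inv (rcl u) = rcl (winv u).
Proof. by apply/rclP/raag_eq_winv/raag_eq_rword. Qed.
Lemma raag_mulVg : left_inverse raag_one raag_inv raag_mul.
Proof.
move=> g; rewrite -(rwordK g) raag_invE raag_mulE.
exact/rclP/raag_eq_winvl.
Qed.
Lemma raag_mulgV : right_inverse raag_one raag_inv raag_mul.
Proof.
move=> g; rewrite -(rwordK g) raag_invE raag_mulE -{1}[rword g]winvK.
exact/rclP/raag_eq_winvl.
Qed.

HB.instance Definition _ := isGroup.Build raag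
  raag_mulA raag_mul1g raag_mulg1 raag_mulVg raag_mulgV.

Definition gen v : raag := rcl [:: (v, false)].
Definition lt l : raag := if l.2 then (gen l.1)^-1 else gen l.1.

Lemma rcl0 : rcl [::] = 1. Proof. by []. Qed.
Lemma rclM u w : rcl (u ++ w) = rcl u * rcl w.
Proof. by rewrite -raag_mulE. Qed.
Lemma rclV u : rcl (winv u) = (rcl u)^-1.
Proof. by rewrite -raag_invE. Qed.
Lemma rcl1 l : rcl [:: l] = lt l.
Proof. by case: l => v [] //=; rewrite /lt /= /gen -rclV. Qed.
Lemma rcl_cons l w : rcl (l :: w) = lt l * rcl w.
Proof. by rewrite -cat1s rclM rcl1. Qed.
Lemma rcl_rcons l w : rcl (rcons w l) = rcl w * lt l.
Proof. by rewrite -cats1 rclM rcl1. Qed.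

Lemma ltN v b : lt (v, ~~ b) = (lt (v, b))^-1.
Proof. by case: b; rewrite /lt /= ?invgK. Qed.

Lemma gen_commute v v' : E v v' -> commute (gen v) (gen v').
Proof.
move=> vw; rewrite /commute /gen -!rclM; apply/rclP.
by have := @re_step _ E [::] _ _ [::] (rs_comm vw).
Qed.

Lemma lt_commute l (g : raag) : commute (gen l.1) g -> commute (lt l) g.
Proof.
case: l => v [] //= /commute_sym c; apply: commute_sym.
by rewrite /lt /=; apply: commuteV.
Qed.

Lemma rcl_commute w (g : raag) :
  (forall l, l \in w -> commute (gen l.1) g) -> commute (rcl w) g.
Proof.
elim: w => [|l w IH] cw; first exact/commute_sym/commute1.
rewrite rcl_cons; apply: commute_sym; apply: commuteM; apply: commute_sym.
  by apply: lt_commute; apply: cw; rewrite mem_head.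
by apply: IH => k kw; apply: cw; rewrite inE kw orbT.
Qed.

End Group.
Bind Scope group_scope with raag.

(** * The universal property of right-angled Artin groups *)

Section Eval.
Variables (V : choiceType) (E : rel V) (H : groupType) (f : V -> H).

Definition ev (w : word V) : H :=
  \prod_(l <- w) (if l.2 then (f l.1)^-1 else f l.1).

Lemma ev_cat u w : ev (u ++ w) = ev u * ev w.
Proof. by rewrite /ev big_cat. Qed.

Lemma ev_cons l w : ev (l :: w) = (if l.2 then (f l.1)^-1 else f l.1) * ev w.
Proof. by rewrite /ev big_cons. Qed.

Lemma ev_winv w : ev (winv w) = (ev w)^-1.
Proof.
elim: w => [|[v b] w IH]; first by rewrite /ev !big_nil invg1.
rewrite -cat1s winv_cat !ev_cat IH invgM; congr (_ * _).
by rewrite /ev /= !big_seq1; case: b => //=; rewrite invgK.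
Qed.

Hypothesis fE : forall v w, E v w -> commute (f v) (f w).

Lemma ev_raag_eq u w : raag_eq E u w -> ev u = ev w.
Proof.
elim=> {u w} [a s t b st|a|a b _ ->|a b d _ -> _ ->] //.
rewrite !ev_cat; congr (_ * (_ * _)); case: st => [v c|v w vw].
  by rewrite /ev !big_cons big_nil /= mulg1; case: c; rewrite /= ?mulVg ?mulgV.
by rewrite /ev !big_cons big_nil /= !mulg1; apply: fE.
Qed.

Definition rlift (g : raag E) : H := ev (rword g).

Lemma rlift_rcl w : rlift (rcl E w) = ev w.
Proof. exact/ev_raag_eq/raag_eq_rword. Qed.

Lemma rliftM g h : rlift (g * h) = rlift g * rlift h.
Proof. by rewrite -(rwordK g) -(rwordK h) -rclM !rlift_rcl ev_cat. Qed.

Lemma rlift1 : rlift 1 = 1.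
Proof. by rewrite -rcl0 rlift_rcl /ev big_nil. Qed.

Lemma rliftV g : rlift g^-1 = (rlift g)^-1.
Proof. by rewrite -(rwordK g) -rclV !rlift_rcl ev_winv. Qed.

Lemma rlift_gen v : rlift (gen E v) = f v.
Proof. by rewrite rlift_rcl /ev big_seq1. Qed.

End Eval.

Lemma ev_gen (V : choiceType) (E : rel V) w : ev (gen E) w = rcl E w.
Proof. by elim: w => [|l w IH]; rewrite ?ev_cons ?IH ?rcl_cons // /ev big_nil. Qed.

(** * Retractions onto standard parabolic subgroups *)

Section Retraction.
Variables (V : choiceType) (E : rel V).
Implicit Types (Y Z : pred V) (g h : raag E).

Definition wfilter Y (w : word V) : word V := [seq l <- w | Y l.1].

Definition retr Y : raag E -> raag E :=
  rlift (fun v => if Y v then gen E v else 1).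

Fact retr_compat Y v w : E v w ->
  commute (if Y v then gen E v else 1) (if Y w then gen E w else 1).
Proof.
move=> vw; case: ifP => _; case: ifP => _; try exact: commute1.
  exact: gen_commute.
exact/commute_sym/commute1.
Qed.

Lemma retr_rcl Y w : retr Y (rcl E w) = rcl E (wfilter Y w).
Proof.
rewrite /retr rlift_rcl; last exact: retr_compat.
elim: w => [|[v b] w IH]; first by rewrite /ev big_nil.
rewrite ev_cons IH /=; case: (Y v); first by rewrite rcl_cons.
by case: b; rewrite ?invg1 mul1g.
Qed.

Lemma retrM Y g h : retr Y (g * h) = retr Y g * retr Y h.
Proof. exact/rliftM/retr_compat. Qed.
Lemma retrV Y g : retr Y g^-1 = (retr Y g)^-1.
Proof. exact/rliftV/retr_compat. Qed.
Lemma retr1 Y : retr Y 1 = 1.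
Proof. exact/rlift1/retr_compat. Qed.
Lemma retrJ Y g h : retr Y (g ^ h) = retr Y g ^ retr Y h.
Proof. by rewrite /conjg !retrM retrV. Qed.
Lemma retrX Y g n : retr Y (g ^+ n) = retr Y g ^+ n.
Proof. by elim: n => [|n IH]; rewrite ?retr1 // !expgS retrM IH. Qed.

Lemma retr_comp Y Z g : retr Y (retr Z g) = retr (fun v => Y v && Z v) g.
Proof.
by rewrite -(rwordK g) !retr_rcl /wfilter -filter_predI.
Qed.

Lemma eq_retr Y Z g : Y =1 Z -> retr Y g = retr Z g.
Proof.
move=> YZ; rewrite -(rwordK g) !retr_rcl; congr rcl.
by apply: eq_filter => l; apply: YZ.
Qed.

(** Membership in the standard parabolic subgroup <Y>, encoded as being fixed by the retraction: it
    is boolean, and its closure properties follow from the multiplicativity of [retr]. *)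
Definition par Y g := retr Y g == g.

Lemma parP Y g : reflect (retr Y g = g) (par Y g).
Proof. exact: eqP. Qed.

Lemma par_retr Y g : par Y (retr Y g).
Proof.
by apply/parP; rewrite retr_comp; apply: eq_retr => v; rewrite andbb.
Qed.
Lemma par1 Y : par Y 1. Proof. by apply/parP; rewrite retr1. Qed.
Lemma parM Y g h : par Y g -> par Y h -> par Y (g * h).
Proof. by move=> /parP eg /parP eh; apply/parP; rewrite retrM eg eh. Qed.
Lemma parV Y g : par Y g^-1 = par Y g.
Proof. by rewrite /par retrV eqg_inv. Qed.
Lemma parX Y g n : par Y g -> par Y (g ^+ n).
Proof. by move=> /parP eg; apply/parP; rewrite retrX eg. Qed.
Lemma parJ Y g h : par Y g -> par Y h -> par Y (g ^ h).
Proof. by move=> Yg Yh; rewrite /conjg !parM // parV. Qed.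
Lemma parMl Y g h : par Y g -> par Y (g * h) = par Y h.
Proof.
move=> Yg; apply/idP/idP; last exact: parM.
by move=> Ygh; rewrite -[h](mulKg g) parM // parV.
Qed.
Lemma par_gen Y v : Y v -> par Y (gen E v).
Proof. by move=> Yv; apply/parP; rewrite retr_rcl /wfilter /= Yv. Qed.

Lemma par_lt Y l : Y l.1 -> par Y (lt E l).
Proof. by case: l => v [] Yv; rewrite /lt /= ?parV par_gen. Qed.

Lemma par_rcl Y w : all (fun l => Y l.1) w -> par Y (rcl E w).
Proof. by move=> Yw; apply/parP; rewrite retr_rcl /wfilter (all_filterP Yw). Qed.

Lemma par_word Y g : par Y g -> exists2 w, g = rcl E w & all (fun l => Y l.1) w.
Proof.
move=> /parP <-; exists (wfilter Y (rword g)); last exact: filter_all.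
by rewrite -{1}(rwordK g) retr_rcl.
Qed.

Lemma sub_par Y Z g : {subset Y <= Z} -> par Y g -> par Z g.
Proof.
move=> YZ /par_word[w -> Yw]; apply: par_rcl.
by apply: sub_all Yw => l /YZ.
Qed.

Lemma par_commute Y g h : (forall v, Y v -> commute (gen E v) h) ->
  par Y g -> commute g h.
Proof.
move=> Yh /par_word[w -> /allP Yw]; apply: rcl_commute => l lw.
exact/Yh/Yw.
Qed.

Lemma par_commute2 Y Z g h : (forall y z, Y y -> Z z -> E y z) ->
  par Y g -> par Z h -> commute g h.
Proof.
move=> YZ Yg Zh; apply: (par_commute _ Yg) => y Yy; apply: commute_sym.
by apply: (par_commute _ Zh) => z Zz; apply/commute_sym/gen_commute/YZ.
Qed.

End Retraction.

(** * Fox derivatives and hyperplanes *)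

Section Integral.
Variables (V : choiceType) (E : rel V).
Hypotheses (Esym : symmetric E) (Eirr : irreflexive E).
Variable x : V.
Implicit Types (g h k : raag E) (u w : word V) (A : raag E -> int).

Lemma lk_commute h : par (E x) h -> commute (gen E x) h.
Proof.
move=> xh; apply: commute_sym; apply: (par_commute _ xh) => v xv.
exact/commute_sym/gen_commute.
Qed.

(** An x-edge is named by the endpoint that x leaves, whatever the direction of travel: reading x^-1
    from h runs backwards along the edge based at h x^-1. *)
Definition edge h (l : letter V) := if l.2 then h * (gen E x)^-1 else h.

Fixpoint edges h w : seq (raag E * bool) :=
  if w is l :: w' then
    (if l.1 == x then [:: (edge h l, l.2)] else [::]) ++ edges (h * lt E l) w'
  else [::].

Lemma edges_cat h u w : edges h (u ++ w) = edges h u ++ edges (h * rcl E u) w.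
Proof.
elim: u h => [|l u IH] h /=; first by rewrite rcl0 mulg1.
by rewrite IH -catA rcl_cons mulgA.
Qed.

Lemma edges_mull g h w :
  edges (g * h) w = [seq (g * e.1, e.2) | e <- edges h w].
Proof.
elim: w h => [|l w IH] h //=.
rewrite map_cat -mulgA IH; congr (_ ++ _).
by case: (l.1 == x) => //=; rewrite /edge; case: l.2; rewrite /= ?mulgA.
Qed.

Lemma size_edges h w : size (edges h w) = count (fun l => l.1 == x) w.
Proof. by elim: w h => [|l w IH] h //=; rewrite size_cat IH; case: (l.1 == x). Qed.

Lemma edges_nil h w : all (fun l => l.1 != x) w -> edges h w = [::].
Proof.
rewrite all_predC has_count -(size_edges h) -leqNgt leqn0.
by move=> /nilP.
Qed.

Definition sgb (b : bool) : int := if b then (-1)%R else 1%R.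

(* [integ A h w] integrates, along the path spelled by w from h in the Cayley
   graph, the 1-form with value [A k] on each edge (k, kx) and 0 on the edges of
   the other generators; invariance under <lk x> makes this form closed. *)
Definition integ A h w : int := (\sum_(e <- edges h w) sgb e.2 * A e.1)%R.

Lemma integ_cat A h u w :
  integ A h (u ++ w) = (integ A h u + integ A (h * rcl E u) w)%R.
Proof. by rewrite /integ edges_cat big_cat. Qed.

Lemma integ_mull A g h w : integ A (g * h) w = integ (fun k => A (g * k)) h w.
Proof. by rewrite /integ edges_mull big_map. Qed.

Definition lk_invariant A := forall k l, par (E x) l -> A (k * l) = A k.

Lemma integ_raag_eq A h u w :
  lk_invariant A -> raag_eq E u w -> integ A h u = integ A h w.
Proof.
move=> Ainv; move=> uw; elim: uw h => {u w} [a s t b st|a|a b _ IH|a b d _ IH _ IH'] h //;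
  last by rewrite IH.
have st_eq : rcl E s = rcl E t.
  by apply/rclP; have := @re_step _ E [::] _ _ [::] st; rewrite /= !cats0.
rewrite !integ_cat st_eq; congr (_ + (_ + _))%R.
move: (h * rcl E a) => {}h.
case: st {st_eq} => [v c|v w vw]; rewrite /integ /=.
  rewrite big_nil; have [->|_] := eqVneq v x; last by rewrite big_nil.
  rewrite !big_cons big_nil /sgb /edge /lt; case: c => /=.
    by rewrite mulN1r mul1r addr0 addNr.
  by rewrite mulgK mul1r mulN1r addr0 addrN.
have [vx|vx] := eqVneq v x; have [wx|wx] := eqVneq w x => /=; rewrite ?big_nil //.
- by rewrite vx wx Eirr in vw.
- rewrite vx in vw; rewrite !big_cons !big_nil /sgb /edge /lt /= Ainv //.
  exact: par_gen.
- rewrite wx Esym in vw; rewrite !big_cons !big_nil /sgb /edge /lt /= Ainv //.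
  exact: par_gen.
Qed.

(* The integral of the constant function 1 is the exponent sum of x. *)
Lemma gen_exp_neq1 n : (0 < n)%N -> rcl E (nseq n (x, false)) <> 1.
Proof.
move=> n0 /rclP /(@integ_raag_eq (fun=> 1%R) 1 _ _) H.
have {H} : integ (fun=> 1%R) 1 (nseq n (x, false)) = 0%R.
  by rewrite H // /integ big_nil.
suff -> : forall h, integ (fun=> 1%R) h (nseq n (x, false)) = n%:R%R.
  by move/eqP; rewrite pnatr_eq0 -leqn0 leqNgt n0.
rewrite /integ; elim: n {n0} => [|n IH] h; first by rewrite big_nil.
by rewrite /= eqxx big_cons IH mulr1 -natr1 addrC.
Qed.

(** The x-hyperplanes correspond to the left cosets of <lk x>: two x-edges are dual to the same one
    when their base points have the same representative. *)
Definition coset_rep h := choose (fun k => par (E x) (h^-1 * k)) h.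

Lemma coset_repP h k : reflect (coset_rep h = coset_rep k) (par (E x) (h^-1 * k)).
Proof.
have refl g : par (E x) (g^-1 * g) by rewrite mulVg par1.
have spl (a b c : raag E) : a^-1 * c = a^-1 * b * (b^-1 * c) by rewrite mulgA mulgK.
apply: (iffP idP) => [hk|e].
  rewrite /coset_rep -(@eq_choose _ (fun g => par (E x) (h^-1 * g))
     (fun g => par (E x) (k^-1 * g))); last first.
    by move=> g; rewrite (spl h k) parMl.
  exact: choose_id.
have := @chooseP _ (fun g => par (E x) (h^-1 * g)) h (refl h).
have := @chooseP _ (fun g => par (E x) (k^-1 * g)) k (refl k).
rewrite -/(coset_rep h) -/(coset_rep k) e => kk hk.
by rewrite (spl _ (coset_rep k)) parM // -parV invgM invgK.
Qed.

Lemma coset_rep_mull g h k :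
  (coset_rep (g * h) == coset_rep (g * k)) = (coset_rep h == coset_rep k).
Proof.
apply/eqP/eqP => /coset_repP H; apply/coset_repP; move: H;
  by rewrite invgM -mulgA mulKg.
Qed.

Lemma coset_rep_mulr h k : par (E x) k -> coset_rep (h * k) = coset_rep h.
Proof. by move=> xk; apply/esym/coset_repP; rewrite mulKg. Qed.

Definition delta k h : int := (coset_rep h == coset_rep k)%:R%R.

Lemma delta_invariant k : lk_invariant (delta k).
Proof. by move=> h l xl; rewrite /delta coset_rep_mulr. Qed.

(* [fox g k] is the coefficient of the coset k<lk x> in the Fox derivative of g
   with respect to x, taken in the permutation module Z[G/<lk x>]. *)
Definition fox g k : int := integ (delta k) 1 (rword g).

Lemma fox_rcl w k : fox (rcl E w) k = integ (delta k) 1 w.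
Proof. by apply: integ_raag_eq; [apply: delta_invariant|apply: raag_eq_rword]. Qed.

Lemma foxM g h k : fox (g * h) k = (fox g k + fox h (g^-1 * k))%R.
Proof.
rewrite -(rwordK g) -(rwordK h) -rclM !fox_rcl integ_cat; congr (_ + _)%R.
rewrite mul1g -{1}[rcl E (rword g)]mulg1 integ_mull.
apply: eq_bigr => e _; rewrite /delta.
by rewrite -(coset_rep_mull (rcl E (rword g))^-1) mulKg.
Qed.

Lemma fox_mulr g k l : par (E x) l -> fox g (k * l) = fox g k.
Proof.
by move=> xl; apply: eq_bigr => e _; rewrite /delta coset_rep_mulr.
Qed.

Lemma fox_coset g h k : coset_rep h = coset_rep k -> fox g h = fox g k.
Proof. by move=> hk; apply: eq_bigr => e _; rewrite /delta hk. Qed.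

Definition hyps h w := [seq coset_rep e.1 | e <- edges h w].

Lemma size_hyps h w : size (hyps h w) = count (fun l => l.1 == x) w.
Proof. by rewrite size_map size_edges. Qed.

Lemma hyps_cat h u w : hyps h (u ++ w) = hyps h u ++ hyps (h * rcl E u) w.
Proof. by rewrite /hyps edges_cat map_cat. Qed.

Lemma uniq_hyps_mull g h w : uniq (hyps (g * h) w) = uniq (hyps h w).
Proof.
rewrite /hyps edges_mull -map_comp; elim: (edges h w) => //= e s ->.
congr (~~ _ && _); elim: s => //= e' s IH; rewrite !inE IH.
by rewrite coset_rep_mull.
Qed.

Lemma uniq_hyps h k w : uniq (hyps h w) = uniq (hyps k w).
Proof. by rewrite -[h](mulgVK k) uniq_hyps_mull. Qed.

Lemma uniq_hyps_infix h u w z : uniq (hyps h (u ++ w ++ z)) -> uniq (hyps h w).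
Proof.
rewrite !hyps_cat !cat_uniq => /and3P[_ _ /andP[]].
by rewrite (uniq_hyps _ h).
Qed.

Lemma fox_notin w k : coset_rep k \notin hyps 1 w -> fox (rcl E w) k = 0%R.
Proof.
move=> kw; rewrite fox_rcl /integ big_seq big1 // => e ew; rewrite /delta.
case: eqP => [ek|_]; last by rewrite mulr0.
by case/negP: kw; rewrite -ek; apply/mapP; exists e.
Qed.

Lemma fox_uniq w e : uniq (hyps 1 w) -> e \in edges 1 w ->
  fox (rcl E w) e.1 = sgb e.2.
Proof.
rewrite fox_rcl /integ /hyps; elim: (edges 1 w) => //= f s IH /andP[fs us].
rewrite inE big_cons /delta => /orP[/eqP ->|es].
  rewrite eqxx mulr1 big_seq big1 ?addr0 // => e' e's.
  case: eqP => [ee'|_]; last by rewrite mulr0.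
  by case/negP: fs; rewrite -ee'; apply/mapP; exists e'.
case: eqP => [fe|_]; last by rewrite mulr0 add0r IH.
by case/negP: fs; rewrite fe; apply/mapP; exists e.
Qed.

Lemma fox_uniq_neq0 w k : uniq (hyps 1 w) ->
  (fox (rcl E w) k != 0%R) = (coset_rep k \in hyps 1 w).
Proof.
move=> uw; apply/idP/idP => [|/mapP[e ew ke]].
  by apply: contraNT => /fox_notin ->.
by rewrite (fox_coset _ ke) fox_uniq // /sgb; case: e.2.
Qed.

Lemma fox_par g k : par (predC1 x) g -> fox g k = 0%R.
Proof.
move=> /par_word[w -> xw]; rewrite fox_rcl /integ edges_nil ?big_nil //.
Qed.

(** Each hyperplane crossed by u has Fox coefficient 1 or -1, so every other spelling of the same
    element must cross it too. *)
Lemma uniq_hyps_count u w : uniq (hyps 1 u) -> rcl E u = rcl E w ->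
  (count (fun l => l.1 == x) u <= count (fun l => l.1 == x) w)%N.
Proof.
move=> uu uw; rewrite -(size_hyps 1) -(size_hyps 1 w); apply: uniq_leq_size => // k.
move=> /mapP[e eu ->]; apply: contraT => /fox_notin.
by rewrite -uw fox_uniq // /sgb; case: e.2.
Qed.

Lemma uniq_hyps_lk w : uniq (hyps 1 w) -> par (E x) (rcl E w) ->
  all (fun l => l.1 != x) w.
Proof.
move=> uw xw; have := @uniq_hyps_count w (wfilter (E x) w) uw.
move/parP: xw; rewrite retr_rcl => -> /(_ erefl).
have -> : count (fun l => l.1 == x) (wfilter (E x) w) = 0%N.
  apply/eqP; rewrite -leqn0 leqNgt -has_count has_filter /wfilter -filter_predI.
  rewrite (eq_filter (a2 := pred0)) ?filter_pred0 // => l /=.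
  by case: eqP => //= ->; rewrite Eirr.
by rewrite leqn0 => /eqP c0; rewrite all_predC has_count c0.
Qed.

(** The pinches of the HNN extension of <V - x> whose stable letter x centralizes <lk x>. *)
Definition pinch w := exists u b v z,
  [/\ w = u ++ (x, b) :: v ++ (x, ~~ b) :: z, all (fun l => l.1 != x) v
    & par (E x) (rcl E v)].

Lemma pinch_infix u w z : pinch w -> pinch (u ++ w ++ z).
Proof.
move=> [u' [b [v [z' [-> xv Lv]]]]]; exists (u ++ u'), b, v, (z' ++ z); split=> //.
by rewrite -!catA /= -catA.
Qed.

(* Britton's lemma. In a shortest subword crossing a hyperplane twice, the part
   between the two crossings has a Fox derivative without cancellation, so it
   lies in <lk x> only if it does not contain x. *)
Lemma britton w : ~~ uniq (hyps 1 w) -> pinch w.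
Proof.
have [n] := ubnP (size w); elim: n w => // n IH w wn Nw.
case: w => [//|l w] in wn Nw *.
have [uw|Nw1] := boolP (uniq (hyps 1 w)); last first.
  by have := @pinch_infix [:: l] w [::]; rewrite cats0; apply; apply: IH.
case/lastP: w => [|v l'] in wn Nw uw *.
  by case/negP: Nw; rewrite /hyps /=; case: (l.1 == x).
have [uv|Nv] := boolP (uniq (hyps 1 (l :: v))); last first.
  have := @pinch_infix [::] (l :: v) [:: l']; rewrite /= cats1; apply; apply: IH => //.
  by move: wn; rewrite /= size_rcons.
have lx : l.1 == x.
  apply: contraNT Nw => lx; rewrite /hyps /= (negbTE lx) /= -/(hyps _ _).
  by rewrite (uniq_hyps _ 1).
have l'x : l'.1 == x.
  apply: contraNT Nw => l'x; rewrite -rcons_cons -cats1 hyps_cat.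
  by rewrite [X in _ ++ X]/hyps /= (negbTE l'x) /= cats0.
have uvv : uniq (hyps 1 v).
  by have := @uniq_hyps_infix 1 [::] v [:: l']; rewrite /= cats1; apply.
(* Neither l v nor v l' repeats a hyperplane, so the repetition is between the edges of l and l'. *)
have same : coset_rep (edge 1 l) = coset_rep (edge (lt E l * rcl E v) l').
  apply/eqP; apply: contraNT Nw => ne.
  have uvl := uw; rewrite (uniq_hyps _ (lt E l)) in uvl.
  move: uv uvl; rewrite -!cats1 /hyps /= !edges_cat /= lx l'x /= mul1g => /andP[lv _].
  by rewrite !map_cat /= => ->; rewrite andbT mem_cat negb_or lv /= inE.
have contra (w0 : word V) : uniq (hyps 1 w0) -> has (fun l => l.1 == x) w0 ->
    par (E x) (rcl E w0) -> False.
  move=> u0 h0 p0; have := uniq_hyps_lk u0 p0.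
  by rewrite all_predC h0.
case: l l' => [y b] [y' b'] /= in wn Nw lx l'x same uv uw *.
move: lx l'x => /eqP yx /eqP y'x; rewrite {y}yx {y'}y'x in wn Nw same uv uw *.
have pch : b' = ~~ b -> par (E x) (rcl E v) -> pinch ((x, b) :: rcons v (x, b')).
  move=> -> Lv; exists [::], b, v, [::]; split=> //=; first by rewrite cats1.
  exact: uniq_hyps_lk.
move: same => /coset_repP; rewrite /edge /lt.
case: b b' => [] [] /= in wn Nw uv uw pch *.
- rewrite mul1g invgK -!mulgA mulVKg => Lv; exfalso.
  apply: (contra _ uw); first by rewrite has_rcons eqxx.
  by rewrite rcl_rcons.
- rewrite mul1g invgK mulVKg; exact: pch.
- rewrite invg1 mul1g => Lv; apply: pch => //.
  suff -> : rcl E v = gen E x * rcl E v / gen E x by [].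
  have /commute_sym := lk_commute Lv; rewrite /commute => cx.
  by apply: (mulgI (gen E x)); rewrite -cx mulgVK.
- rewrite invg1 mul1g => Lv; exfalso.
  by apply: (contra _ uv); rewrite /= ?eqxx // rcl_cons.
Qed.

End Integral.

(** * Minimal words and pigeonhole arguments *)

Lemma shortest (T : Type) (P : seq T -> Prop) : (exists u, P u) ->
  exists2 u, P u & forall u', P u' -> size u <= size u'.
Proof.
move=> [u Pu]; pose Q n := `[< exists2 u, P u & size u = n >].
have exQ : exists n, Q n by exists (size u); apply/asboolP; exists u.
case: (ex_minnP exQ) => n /asboolP[u0 Pu0 <-] min; exists u0 => // u' Pu'.
by apply: min; apply/asboolP; exists u'.
Qed.

Lemma pigeonhole_seq (T : eqType) (f : nat -> T) (s : seq T) :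
  (forall n, f n \in s) -> exists m n, m < n /\ f m = f n.
Proof.
move=> fs; apply/not_existsP => Nf.
have inj : {in iota 0 (size s).+1 &, injective f}.
  move=> m n _ _ fmn; apply/eqP; case: ltngtP => // mn.
    by case: (Nf m); exists n.
  by case: (Nf n); exists m.
have uf : uniq (map f (iota 0 (size s).+1)) by rewrite map_inj_in_uniq ?iota_uniq.
have := @uniq_leq_size _ _ s uf; rewrite size_map size_iota ltnn => H.
by suff : false by []; apply: H => _ /mapP[n _ ->].
Qed.

Lemma eventually_notin (T : eqType) (f : nat -> T) (s : seq T) :
  injective f -> exists n0, forall n, n0 <= n -> f n \notin s.
Proof.
move=> finj; elim: s => [|a s [n0 IH]]; first by exists 0.
have [[m fm]|Nm] := pselect (exists m, f m = a).
  exists (maxn n0 m.+1) => n; rewrite geq_max inE negb_or => /andP[n0n mn].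
  rewrite IH // andbT; apply: contraTneq mn => fna.
  by rewrite (finj n m) ?ltnn // fm.
exists n0 => n n0n; rewrite inE negb_or IH // andbT.
by apply/eqP => fna; apply: Nm; exists n.
Qed.

Lemma split_first (T : Type) (P : pred T) (s : seq T) : ~~ all P s ->
  exists a y c, [/\ s = a ++ y :: c, all P a & ~~ P y].
Proof.
elim: s => //= y s IH; case: (boolP (P y)) => [Py|NPy] /=; last first.
  by exists [::], y, s.
by move=> /IH[a [z [c [-> Pa Pz]]]]; exists (y :: a), z, c; rewrite /= Py.
Qed.

(** * Cyclically reduced words *)

Section CyclicallyReduced.
Variables (V : choiceType) (E : rel V).
Hypotheses (Esym : symmetric E) (Eirr : irreflexive E).
Implicit Types (g h k : raag E) (u w : word V) (x y : V).

Definition geod w := forall u, rcl E u = rcl E w -> size w <= size u.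
Definition cmin w := forall u g, rcl E u = rcl E w ^ g -> size w <= size u.

Lemma geod_exists g : exists2 u, g = rcl E u & geod u.
Proof.
have [|u <- min] := @shortest _ (fun u => rcl E u = g).
  by exists (rword g); rewrite rwordK.
by exists u.
Qed.

Lemma cmin_geod w : cmin w -> geod w.
Proof. by move=> cw u uw; apply: (cw u 1); rewrite conjg1. Qed.

Lemma cmin_exists g : exists w k, g = rcl E w ^ k /\ cmin w.
Proof.
have [|u [k uk] min] := @shortest _ (fun u => exists k, rcl E u ^ k = g).
  by exists (rword g), 1; rewrite conjg1 rwordK.
exists u, k; split=> // u' h u'h; apply: min; exists (h^-1 * k).
by rewrite u'h conjgM conjgK.
Qed.

Lemma geod_par w (Y : pred V) : geod w -> par Y (rcl E w) -> all (fun l => Y l.1) w.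
Proof.
move=> gw /parP; rewrite retr_rcl => /gw; rewrite size_filter all_count => H.
by rewrite eqn_leq count_size.
Qed.

Lemma cmin_rot u w : cmin (u ++ w) -> cmin (w ++ u).
Proof.
move=> cm z g e; have := cm z ((rcl E u) * g).
rewrite !size_cat addnC; apply; rewrite e !rclM.
by rewrite conjgM; congr (_ ^ g); rewrite /conjg !mulgA mulVg mul1g.
Qed.

Lemma pinch_shorten x w : pinch E x w -> exists2 u, rcl E u = rcl E w & size u < size w.
Proof.
move=> [u [b [v [z [-> _ Lv]]]]]; exists (u ++ v ++ z); last first.
  by rewrite !size_cat /= size_cat /= !addnS ltnS leqnSn.
rewrite !rclM rcl_cons !rclM rcl_cons ltN; congr (_ * _).
have /commute_sym cx := lk_commute Lv.
have /commute_sym {}cx : commute (lt E (x, b)) (rcl E v) by apply/lt_commute/commute_sym.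
by rewrite !mulgA -cx mulgK.
Qed.

Lemma geod_Npinch x w : geod w -> ~ pinch E x w.
Proof. by move=> gw /pinch_shorten[u /gw]; rewrite leqNgt => /negP. Qed.

Lemma geod_uniq x w : geod w -> uniq (hyps x (1 : raag E) w).
Proof. by move=> gw; apply/negP=> /negP /(britton Esym Eirr) /(geod_Npinch gw). Qed.

Lemma pinch_split x e a c : pinch E x (a ++ (x, e) :: c) ->
  pinch E x (rcons a (x, e)) \/ pinch E x ((x, e) :: c).
Proof.
have levi (v z : word V) b a' : all (fun l => l.1 != x) v ->
    v ++ (x, b) :: z = a' ++ (x, e) :: c ->
    exists z', rcons a' (x, e) = v ++ (x, b) :: z'.
  elim: v a' => [|l v IH] [|l' a'] //=.
  - by move=> _ [-> _]; exists [::].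
  - by move=> _ [-> _]; exists (rcons a' (x, e)).
  - by move=> /andP[lx _] [le _]; rewrite le eqxx in lx.
  - by move=> /andP[_ xv] [-> /(IH _ xv)[z' ->]]; exists z'.
move=> [u [b [v [z [eq xv Lv]]]]]; elim: a u eq => [|l a IH] u eq.
  by right; exists u, b, v, z; split=> //; rewrite -eq.
case: u eq => [|l' u] [-> eq] /=.
  have [z' ->] := levi _ _ _ _ xv (esym eq).
  by left; exists [::], b, v, z'.
case: (IH u eq) => [p|]; last by right.
by left; have := @pinch_infix _ E x [:: l'] _ [::] p; rewrite cats0.
Qed.

Definition wexp w n : word V := flatten (nseq n w).

Lemma rcl_wexp w n : rcl E (wexp w n) = rcl E w ^+ n.
Proof. by elim: n => [|n IH] //; rewrite /wexp /= rclM IH expgS. Qed.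

Lemma wexpSr w n : wexp w n.+1 = wexp w n ++ w.
Proof.
by elim: n => [|n IH]; rewrite /wexp /= ?cats0 // -catA -IH.
Qed.

Lemma wexpD w m n : wexp w (m + n) = wexp w m ++ wexp w n.
Proof. by rewrite /wexp nseqD flatten_cat. Qed.

Lemma wexp_rot u w n : wexp (u ++ w) n.+1 = u ++ wexp (w ++ u) n ++ w.
Proof.
elim: n => [|n IH]; first by rewrite /wexp /= cats0.
by rewrite wexpSr IH (wexpSr _ n) !catA.
Qed.

(** By rotation w starts with x. A repeated hyperplane in a power gives a pinch, which [pinch_split]
    confines to one period followed by the next x. It is not the whole of that word, whose end
    letters agree; so it lies in w or in a rotation of w, both geodesic. *)
Lemma cmin_wexp_uniq x w n : cmin w -> uniq (hyps x (1 : raag E) (wexp w n)).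
Proof.
wlog [e [q ->]] : w n / exists e q, w = (x, e) :: q.
  move=> wl cw; have [/hasP[[y e] lw /eqP/= yx]|Nx] := boolP (has (fun l => l.1 == x) w).
    rewrite {y}yx in lw; move/splitPr: lw cw => [a c] cw; have := cmin_rot cw.
    rewrite cat_cons => /(wl _ n.+1) H.
    have {}H : uniq (hyps x (1 : raag E) (wexp ((x, e) :: c ++ a) n.+1)).
      by apply: H; exists e, (c ++ a).
    move: H; rewrite -cat_cons wexp_rot.
    by apply: uniq_hyps_infix.
  rewrite /hyps edges_nil //; elim: n => // n IH.
  by rewrite /wexp /= all_cat IH andbT all_predC.
move=> cw; apply/negP => /negP /(britton Esym Eirr) pw.
suff : pinch E x (rcons ((x, e) :: q) (x, e)).
  move=> [u [b [v [z [eq xv Lv]]]]]; case/lastP: z eq => [|z l] eq.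
    case: u eq => [|l u] [].
      by rewrite -!cats1 => <- /(congr1 (last (x, ~~ e))); rewrite !last_cat; case: (e).
    move=> _ eq; apply: (@geod_Npinch x (rcons q (x, e))); last by exists u, b, v, [::].
    by apply: cmin_geod; rewrite -cats1; apply: cmin_rot.
  apply: (@geod_Npinch x _ (cmin_geod cw)); exists u, b, v, z; split=> //.
  suff : rcons ((x, e) :: q) (x, e) = rcons (u ++ (x, b) :: v ++ (x, ~~ b) :: z) l.
    by move=> /rcons_inj/(congr1 fst).
  by rewrite eq rcons_cat /= rcons_cat.
elim: n pw => [|n IH]; first by move=> [[|? ?] [b [v [z []]]]].
case: n IH => [|n] IH; rewrite /wexp /=.
  rewrite cats0 => pw; have := @pinch_infix _ E x [::] _ [:: (x, e)] pw.
  by rewrite -cats1.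
rewrite -cat_cons => /pinch_split[//|pw]; exact: IH.
Qed.

(** The power w^(nm) crosses at least nm x-hyperplanes. If a conjugate of w^n had a spelling c
    without x, the same element would be k c^m k^-1, in which the number of letters x does not
    depend on m. *)
Lemma cmin_conj_Npar x w n k : cmin w -> x \in unzip1 w -> 0 < n ->
  ~~ par (predC1 x) ((rcl E w ^+ n) ^ k).
Proof.
move=> cw xw n0; apply/negP => /par_word[c ec xc].
pose cnt := count (fun l : letter V => l.1 == x).
have cntD u u' : cnt (u ++ u') = (cnt u + cnt u')%N by apply: count_cat.
have cw0 : 0 < cnt w.
  by move/mapP: xw => [l lw xl]; rewrite -has_count; apply/hasP; exists l; rewrite // xl.
have cntX u m : cnt (wexp u m) = (m * cnt u)%N.
  by elim: m => // m IH; rewrite /wexp /= cntD IH mulSn.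
have c0 : cnt c = 0 by apply/eqP; rewrite -leqn0 leqNgt -has_count -all_predC.
have [m mE] : exists m, m = (2 * cnt (rword k)).+1 by eexists.
have := @uniq_hyps_count _ E Esym Eirr x (wexp w (n * m))
  (rword k ++ wexp c m ++ winv (rword k)) (cmin_wexp_uniq _ _ cw).
rewrite -!/(cnt _) !cntD !cntX c0 muln0 !rclM rclV !rcl_wexp rwordK.
have -> : cnt (winv (rword k)) = cnt (rword k).
  by rewrite /winv /cnt -map_rev count_map count_rev.
rewrite expgnA -ec -conjXg {1}/conjg -!mulgA mulVKg mulgV mulg1 => /(_ erefl).
rewrite add0n addnn -mul2n leqNgt => /negP[]; rewrite -ltnS -mE ltnS.
by rewrite -[X in X <= _]mul1n mulnAC leq_mul // muln_gt0 n0.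
Qed.

Lemma cmin_conj_supp w w' k : cmin w -> rcl E w ^ k = rcl E w' ->
  {subset unzip1 w <= unzip1 w'}.
Proof.
move=> cw ww' x xw; have := @cmin_conj_Npar x w 1 k cw xw isT.
rewrite expg1 ww'; apply: contraNT => xw'; apply: par_rcl; apply/allP => l lw' /=.
by apply: contraNneq xw' => <-; apply: map_f.
Qed.

Lemma cmin_exp_neq1 w n : cmin w -> w != [::] -> 0 < n -> rcl E w ^+ n <> 1.
Proof.
case: w => // l w cw _ n0 e; have := @cmin_conj_Npar l.1 _ n 1 cw _ n0.
by rewrite e conj1g par1 mem_head => /(_ isT).
Qed.

(** The subgroup <nbs s> is the product of <s> and of the subgroup of the common link of s. It
    contains the centralizer of each nontrivial power of a cyclically reduced word with support
    s. *)
Definition lks (s : seq V) : pred V := fun z => all (E z) s.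
Definition nbs (s : seq V) : pred V := fun z => (z \in s) || lks s z.

(* If z is the first letter of t outside the support of w, then the z-hyperplanes
   of t are permuted by r = w^n, so a power of r fixes the first one; hence z
   commutes with the support of w. *)
Lemma cmin_conj_nbs w n t h : cmin w -> 0 < n -> par (mem (unzip1 w)) h ->
  rcl E w ^+ n * t = t * h -> par (nbs (unzip1 w)) t.
Proof.
move=> cw n0 Yh; set s := unzip1 w; set R := rcl E w ^+ n.
have [u -> gu] := geod_exists t; have [m] := ubnP (size u).
elim: m u gu => // m IH u gu um eq.
have [us|] := boolP (all (fun l => l.1 \in s) u).
  by apply: par_rcl; apply: sub_all us => l ls; rewrite /nbs ls.
case/split_first=> [a [[z b] [c [eu as_ /= zs]]]].
have eqX M : R ^+ M * rcl E u = rcl E u * h ^+ M.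
  elim: M => [|M IHM]; first by rewrite mul1g mulg1.
  by rewrite expgSr -mulgA eq mulgA IHM -mulgA -expgSr.
have foxz (g : raag E) k : par (mem s) g -> fox z g k = 0%R.
  move=> sg; apply: fox_par => //; apply: sub_par sg => y ys; rewrite !inE.
  by apply: contraNneq zs => <-.
have sR : par (mem s) R.
  by apply: parX; apply: par_rcl; apply/allP => l lw; apply: map_f.
have foxu k M : fox z (rcl E u) (R ^- M * k) = fox z (rcl E u) k.
  have := foxM Esym Eirr z (rcl E u) (h ^+ M) k.
  by rewrite -eqX foxM // (foxz _ _ (parX M sR)) (foxz _ _ (parX M Yh)) add0r addr0.
have [e0 e0u _] : exists2 e0, e0 \in edges z (1 : raag E) u & True.
  exists (edge z (1 * rcl E a) (z, b), b) => //.
  by rewrite eu edges_cat /= eqxx mem_cat inE eqxx orbT.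
have uu := geod_uniq z gu.
have e0nz : fox z (rcl E u) e0.1 != 0%R.
  by rewrite fox_uniq_neq0 //; apply: map_f.
have [|M1 [M2 [M12]]] := @pigeonhole_seq _ (fun M => coset_rep z (R ^- M * e0.1)) (hyps z 1 u).
  by move=> M; rewrite -fox_uniq_neq0 // foxu.
move=> /esym /coset_repP; rewrite invgM invgK -(subnK (ltnW M12)) expgnDr !mulgA mulgK.
rewrite -[X in par _ X]mulgA -/(R ^+ _ ^ e0.1) -expgnA => Lz.
have zs_all : all (E z) s.
  apply/allP => y ys; apply: contraT => Nzy.
  have := @cmin_conj_Npar y w (n * (M2 - M1)) e0.1 cw ys.
  rewrite muln_gt0 n0 subn_gt0 M12 => /(_ isT) /negP[].
  apply: sub_par Lz => v zv; rewrite !inE.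
  by apply: contraNneq Nzy => <-.
have zs_comm g : par (mem s) g -> commute (lt E (z, b)) g.
  move=> sg; apply: commute_sym; apply: (par_commute _ sg) => y ys.
  apply: commute_sym; apply: lt_commute; apply: gen_commute.
  exact: (allP zs_all).
have eu' : rcl E u = lt E (z, b) * rcl E (a ++ c).
  rewrite eu !rclM rcl_cons !mulgA; congr (_ * _); apply/esym/zs_comm.
  exact: par_rcl.
have [u' u'E gu'] := geod_exists (rcl E (a ++ c)).
rewrite eu' u'E; apply: parM; first by apply: par_lt; rewrite /nbs /= /lks zs_all orbT.
apply: IH => //.
  apply: leq_ltn_trans (gu' (a ++ c) u'E) _.
  by rewrite -ltnS; apply: leq_trans um; rewrite eu !size_cat /= addnS.
apply: (mulgI (lt E (z, b))); rewrite -u'E mulgA (zs_comm _ sR) -mulgA -eu' eq eu'.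
by rewrite mulgA.
Qed.

Lemma cmin_commute_nbs w n g : cmin w -> 0 < n -> commute (rcl E w ^+ n) g ->
  par (nbs (unzip1 w)) g.
Proof.
move=> cw n0 cg; apply: (@cmin_conj_nbs w n g (rcl E w ^+ n)) => //.
by apply: parX; apply: par_rcl; apply/allP => l lw; apply: map_f.
Qed.

Lemma cmin_gen x : cmin [:: (x, false)].
Proof.
move=> [|//] g /=; rewrite rcl0 => /esym/eqP; rewrite conjg_eq1 => /eqP.
by case/(@gen_exp_neq1 _ E Esym Eirr x 1 isT).
Qed.

Definition star x : pred V := fun z => (z == x) || E x z.

Lemma commute_gen_star x n g : 0 < n -> commute (gen E x ^+ n) g -> par (star x) g.
Proof.
move=> n0 cg; have := cmin_commute_nbs (@cmin_gen x) n0 cg.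
by apply: sub_par => z; rewrite /in_mem /= /nbs /lks /star /= inE andbT Esym.
Qed.

Lemma star_commute x g : par (star x) g -> commute (gen E x) g.
Proof.
move=> sg; apply: commute_sym; apply: (par_commute _ sg) => z /orP[/eqP ->//|xz].
exact/commute_sym/gen_commute.
Qed.

Lemma commute_genX x n g : 0 < n -> commute (gen E x ^+ n) g -> commute (gen E x) g.
Proof. by move=> n0 /(commute_gen_star n0)/star_commute. Qed.

Lemma commute_gen x y : commute (gen E x) (gen E y) -> x != y -> E x y.
Proof.
move=> /(@commute_gen_star x 1 _ isT) /(geod_par (cmin_geod (@cmin_gen y))) /=.
by rewrite andbT /star eq_sym => /orP[/eqP ->|//]; rewrite eqxx.
Qed.

End CyclicallyReduced.

Lemma conjg_commute (G : groupType) (a b c : G) :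
  commute a b -> commute (a ^ c) (b ^ c).
Proof. by rewrite /commute -!conjMg => ->. Qed.

Lemma commute_conjg (G : groupType) (a b : G) : commute a b -> a ^ b = a.
Proof. by move=> cab; apply/conjg_fixP/commgP. Qed.

(** * Irreducible elements and centralizers *)

Section Irreducible.
Variables (V : choiceType) (E : rel V).
Hypotheses (Esym : symmetric E) (Eirr : irreflexive E).
Implicit Types (g h k : raag E) (u w : word V) (x y : V) (s : seq V).

(** Connectedness of the complement graph on s: every partition of s into two nonempty parts is
    crossed by a non-edge, so s is not a join. *)
Definition irr s := forall T : pred V,
  has T s -> has (predC T) s ->
  exists t t', [/\ t \in s, t' \in s, T t, ~~ T t' & ~~ E t t'].

Lemma par_supp w : par (mem (unzip1 w)) (rcl E w).
Proof. by apply: par_rcl; apply/allP => l lw; apply: map_f. Qed.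

Lemma cmin_par_conj (Y : pred V) g : par Y g -> exists w k,
  [/\ g = rcl E w ^ k, cmin E w, all (fun l => Y l.1) w & par Y k].
Proof.
move=> /parP Yg; have [w [k [gw cw]]] := cmin_exists g.
have ew : rcl E w ^ k = rcl E (wfilter Y w) ^ retr Y k.
  by rewrite -gw -{1}Yg gw retrJ retr_rcl.
have Yw : all (fun l => Y l.1) w.
  have := cw (wfilter Y w) (k / retr Y k).
  rewrite conjgM ew conjgK => /(_ erefl); rewrite size_filter all_count => H.
  by rewrite eqn_leq count_size.
exists w, (retr Y k); split; rewrite ?par_retr //.
by rewrite gw ew [wfilter Y w](all_filterP Yw).
Qed.

Lemma cmin_cat w w' (Y Z : pred V) : (forall v, Y v -> ~~ Z v) ->
  all (fun l => Y l.1) w -> all (fun l => Z l.1) w' -> cmin E w -> cmin E w' ->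
  cmin E (w ++ w').
Proof.
move=> YZ Yw Zw' cw cw' u g e.
have wfn (A B : pred V) (z : word V) : (forall v, A v -> ~~ B v) ->
    all (fun l => A l.1) z -> wfilter B z = [::].
  move=> AB Az; apply/nilP; rewrite /nilp size_filter eqn0Ngt -has_count -all_predC.
  by apply: sub_all Az => l /AB.
have ZY v : Z v -> ~~ Y v by apply: contraL => /YZ.
have wfc (A : pred V) : wfilter A (w ++ w') = wfilter A w ++ wfilter A w' by apply: filter_cat.
have := congr1 (retr Y) e; rewrite retrJ !retr_rcl wfc (wfn _ _ _ ZY Zw') cats0.
rewrite [wfilter Y w](all_filterP Yw) => /cw le1.
have := congr1 (retr Z) e; rewrite retrJ !retr_rcl wfc (wfn _ _ _ YZ Yw).
rewrite [wfilter Z w'](all_filterP Zw') => /cw' le2.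
rewrite size_cat (leq_trans (leq_add le1 le2)) // !size_filter.
rewrite -count_predUI [X in _ + X](_ : _ = 0) ?addn0 ?count_size //.
apply/eqP; rewrite eqn0Ngt -has_count -all_predC; apply/allP => l _ /=.
by rewrite negb_and -implybE; apply/implyP/YZ.
Qed.

Lemma retr_split (Y Z : pred V) g : (forall y z, Y y -> Z z -> E y z) ->
  par (fun v => Y v || Z v) g -> g = retr Y g * retr Z g.
Proof.
move=> YZ /par_word[w -> yzw]; rewrite !retr_rcl.
elim: w yzw => [|l w IH] /=; first by rewrite mul1g.
move=> /andP[yzl /IH {IH} e]; have [Yl|NYl] := boolP (Y l.1).
  have -> : Z l.1 = false by apply/negP => Zl; have := YZ _ _ Yl Zl; rewrite Eirr.
  by rewrite !rcl_cons -mulgA -e.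
rewrite (negbTE NYl) /= in yzl; rewrite yzl !rcl_cons e !mulgA; congr (_ * _).
apply: (@par_commute2 _ E Z Y); last by apply: par_rcl; apply: filter_all.
  by move=> z y Zz Yy; rewrite Esym YZ.
exact: par_lt.
Qed.

Lemma lks_adj s y z : y \in s -> lks E s z -> E y z.
Proof. by move=> ys /allP /(_ _ ys); rewrite Esym. Qed.

Lemma lks_commute s g h : par (mem s) g -> par (lks E s) h -> commute g h.
Proof. by apply: par_commute2 => y z; apply: lks_adj. Qed.

Lemma nbs_split s g : par (nbs E s) g ->
  exists a b, [/\ g = a * b, par (mem s) a & par (lks E s) b].
Proof.
move=> ng; exists (retr (mem s) g), (retr (lks E s) g); rewrite !par_retr; split=> //.
by apply: retr_split ng => y z; apply: lks_adj.
Qed.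

Lemma nbs_conj s g h : par (nbs E s) g -> par (mem s) h -> par (mem s) (h ^ g).
Proof.
move=> /nbs_split[a [b [-> sa sb]]] sh; rewrite conjgM.
by rewrite (@commute_conjg _ (h ^ a)) ?parJ //; apply: (lks_commute _ sb); apply: parJ.
Qed.

Lemma cmin_conj_par (Y : pred V) w k : cmin E w -> par Y (rcl E w ^ k) ->
  {in unzip1 w, forall v, Y v}.
Proof.
move=> cw Yw v vw; apply: contraT => NYv.
have := cmin_conj_Npar Esym Eirr k cw vw (ltn0Sn 0); rewrite expg1 => /negP[].
apply: sub_par Yw => y Yy; rewrite !inE; apply: contraNneq NYv => <-; exact: Yy.
Qed.

(** Let s be the support of w1. The conjugate lies in <s> x <lk s>, and the cyclic reductions of its
    two components concatenate to a word with the support of w2. If both were nonempty, this support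
    would be a join, against [irr]. *)
Lemma irr_split w1 w2 k : cmin E w1 -> cmin E w2 -> irr (unzip1 w2) ->
  commute (rcl E w1) (rcl E w2 ^ k) ->
  par (mem (unzip1 w1)) (rcl E w2 ^ k) \/ par (lks E (unzip1 w1)) (rcl E w2 ^ k).
Proof.
move=> c1 c2 i2 com; set s := unzip1 w1.
have [|a [b [eab sa lb]]] := @nbs_split s (rcl E w2 ^ k).
  by apply: (@cmin_commute_nbs _ E Esym Eirr w1 1).
have [al [p [ea cal sal sp]]] := cmin_par_conj sa.
have [be [q [eb cbe lbe lq]]] := cmin_par_conj lb.
have e2 : rcl E w2 ^ k = rcl E (al ++ be) ^ (p * q).
  rewrite eab ea eb rclM conjMg; congr (_ * _).
    rewrite conjgM (@commute_conjg _ (rcl E al ^ p)) //.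
    by apply: lks_commute lq; rewrite parJ // par_rcl.
  rewrite conjgM (@commute_conjg _ (rcl E be)) //; apply: commute_sym.
  by apply: (lks_commute sp); apply: par_rcl.
have dis v : v \in s -> ~~ lks E s v.
  by move=> vs; apply/negP => /(lks_adj vs); rewrite Eirr.
have cab : cmin E (al ++ be) by apply: (@cmin_cat al be (mem s) (lks E s)).
have sub1 : {subset unzip1 w2 <= unzip1 (al ++ be)}.
  apply: (cmin_conj_supp Esym Eirr c2).
  by rewrite -(conjgK (p * q) (rcl E (al ++ be))) -e2 -conjgM.
have sub2 : {subset unzip1 (al ++ be) <= unzip1 w2}.
  by apply: (cmin_conj_supp Esym Eirr cab); rewrite -(conjgK k (rcl E w2)) e2 -conjgM.
case: al => [|l al] in ea cal sal e2 cab sub1 sub2 *.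
  by right; rewrite eab ea rcl0 conj1g mul1g.
case: be => [|l' be] in eb cbe lbe e2 cab sub1 sub2 *.
  by left; rewrite eab eb rcl0 conj1g mulg1.
have ls : l.1 \in s by move: sal => /= /andP[].
have l's : l'.1 \notin s by apply/negP => /dis; move: lbe => /= /andP[->].
have [||t [u [/sub1 tw /sub1 uw ts us Ntu]]] := i2 (mem s).
- apply/hasP; exists l.1; rewrite //; apply: sub2; exact: mem_head.
- apply/hasP; exists l'.1; rewrite //; apply: sub2.
  by rewrite /unzip1 map_cat mem_cat mem_head orbT.
case/negP: Ntu; apply: (lks_adj ts); move: uw.
rewrite /unzip1 map_cat mem_cat => /orP[/mapP[m ml um]|/mapP[m ml um]].
  by case/negP: us; rewrite um; apply: (allP sal).
by rewrite um; apply: (allP lbe).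
Qed.

(** Inside <Y>, the element w^t is conjugate by some p to a cyclically reduced word. Then t / p
    conjugates w to a word of the same support, so it normalizes <supp w> by [cmin_conj_nbs] and
    [nbs_conj]. *)
Lemma parabolic_closure (Y : pred V) w t h : cmin E w -> par Y (rcl E w ^ t) ->
  par (mem (unzip1 w)) h -> par Y (h ^ t).
Proof.
move=> cw Yw sh; have [si [p [e csi Ysi Yp]]] := cmin_par_conj Yw.
have e' : rcl E w ^ (t / p) = rcl E si by rewrite conjgM e conjgK.
have sub : {subset unzip1 si <= unzip1 w}.
  apply: (cmin_conj_supp Esym Eirr csi (k := (t / p)^-1)).
  by rewrite -e' conjgK.
have sub' := cmin_conj_supp Esym Eirr cw e'.
have nt : par (nbs E (unzip1 w)) (t / p).
  apply: (@cmin_conj_nbs _ E Esym Eirr w 1 _ (rcl E si)) => //.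
    by apply: sub_par (par_supp si).
  by rewrite expg1 -e' conjgC.
rewrite -[t](mulgVK p) conjgM; apply: parJ => //.
apply: sub_par (nbs_conj nt sh) => y /sub' /mapP[l lsi ->].
exact: (allP Ysi).
Qed.

Lemma raag_torsion_free k n : 0 < n -> k ^+ n = 1 -> k = 1.
Proof.
move=> n0; have [w [g [-> cw]]] := cmin_exists k; rewrite -conjXg => /eqP.
rewrite conjg_eq1 => /eqP; case: (eqVneq w [::]) => [->|w0]; first by rewrite rcl0 conj1g.
by move=> /(cmin_exp_neq1 Esym Eirr cw w0 n0).
Qed.

End Irreducible.

(** * Axes, translation lengths and centralizers of irreducible elements *)

Section Centralizer.
Variables (V : choiceType) (E : rel V).
Hypotheses (Esym : symmetric E) (Eirr : irreflexive E).
Implicit Types (g h k : raag E).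
Variables (w : word V) (x : V).
Hypotheses (cw : cmin E w) (iw : irr E (unzip1 w)) (xw : x \in unzip1 w).
Notation r := (rcl E w).

Lemma lk_predC1 g : par (E x) g -> par (predC1 x) g.
Proof.
by apply: sub_par => y; rewrite !inE /in_mem /=; apply: contraTneq => ->; rewrite Eirr.
Qed.

Lemma coset_exp_inj k : injective (fun n => coset_rep x (r ^+ n * k)).
Proof.
move=> m n; wlog mn : m n / m <= n.
  by move=> H; case: (leqP m n) => [|/ltnW] le e; [apply: H | apply/esym/H].
move=> /coset_repP; rewrite -(subnKC mn); case: (n - m) => [|d]; first by rewrite addn0.
rewrite expgnDr invgM -!mulgA mulKg mulgA => /lk_predC1.
by rewrite -[X in par _ X]mulgA (negbTE (cmin_conj_Npar Esym Eirr k cw xw (ltn0Sn d))).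
Qed.

Lemma coset_expV_inj k : injective (fun n => coset_rep x (r ^- n * k)).
Proof.
move=> m n e; apply/esym; apply: (@coset_exp_inj k); apply/eqP.
have aux a b : r ^- (a + b) * (r ^+ b * k) = r ^- a * k.
  by rewrite addnC expgnDr invgM -mulgA mulKg.
by rewrite -(coset_rep_mull x (r ^- (m + n))) aux addnC aux e.
Qed.

Lemma fox_eventually g k : exists n0, forall n, n0 <= n ->
  fox x g (r ^+ n * k) = 0%R /\ fox x g (r ^- n * k) = 0%R.
Proof.
have [n1 H1] := eventually_notin (hyps x 1 (rword g)) (@coset_exp_inj k).
have [n2 H2] := eventually_notin (hyps x 1 (rword g)) (@coset_expV_inj k).
exists (maxn n1 n2) => n; rewrite geq_max => /andP[/H1 l1 /H2 l2].
by split; rewrite -(rwordK g) fox_notin.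
Qed.

(* The signed x-hyperplanes crossed by the axis of r; the segment from r^-n to
   r^n is translated by r^n in order to be an element of the group. *)
Definition segment n k := fox x (r ^+ (n + n)) (r ^+ n * k).

(** Passing from n to n+1 adds the Fox coefficients of r at r^(n+1) k and at r^-n k, which vanish
    for n large. *)
Lemma segment_lim k : exists a, exists n0, forall n, n0 <= n -> segment n k = a.
Proof.
have [n0 H] := fox_eventually r k; exists (segment n0 k), n0 => n.
elim: n => [|n IH]; first by rewrite leqn0 => /eqP ->.
rewrite leq_eqVlt => /orP[/eqP -> //|]; rewrite ltnS => n0n; rewrite -IH // /segment.
have -> : r ^+ (n.+1 + n.+1) = r * (r ^+ (n + n) * r).
  by rewrite addnS addSn expgS expgSr.
rewrite !foxM // [r^-1 * _]mulgA {2 3}expgS mulKg.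
have -> : r ^- (n + n) * (r ^+ n * k) = r ^- n * k.
  by rewrite expgnDr invgM -mulgA mulKg.
have [_ ->] := H n n0n; have [-> _] := H n.+1 (leqW n0n).
by rewrite add0r addr0.
Qed.

Lemma axis_exists : exists A : raag E -> int,
  forall k, exists n0, forall n, n0 <= n -> segment n k = A k.
Proof. by have [A HA] := choice segment_lim; exists A. Qed.

Section Axis.
Variable A : raag E -> int.
Hypothesis A_lim : forall k, exists n0, forall n, n0 <= n -> segment n k = A k.

Lemma axis_invariant : lk_invariant x A.
Proof.
move=> k l xl; have [n1 H1] := A_lim k; have [n2 H2] := A_lim (k * l).
rewrite -(H1 _ (leq_maxl n1 n2)) -(H2 _ (leq_maxr n1 n2)).
by rewrite /segment mulgA fox_mulr.
Qed.

(** Expand the Fox derivative of g r^(2n) = r^(2n) g in both ways: the two terms that come from g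
    vanish for n large. *)
Lemma axis_centralizer g k : commute r g -> A (g * k) = A k.
Proof.
move=> rg; have [n1 H1] := A_lim k; have [n2 H2] := A_lim (g * k).
have [n3 H3] := fox_eventually g (g * k).
pose n := maxn n3 (maxn n1 n2).
have [n3n n1n n2n] : [/\ n3 <= n, n1 <= n & n2 <= n].
  by rewrite !leq_max !leqnn !orbT.
rewrite -(H1 n n1n) -(H2 n n2n) /segment; have [f1 f2] := H3 n n3n.
have cg m : commute g (r ^+ m) by apply/commuteX/commute_sym.
have := foxM Esym Eirr x g (r ^+ (n + n)) (r ^+ n * (g * k)).
rewrite (cg (n + n)) foxM // f1 add0r.
have -> : r ^- (n + n) * (r ^+ n * (g * k)) = r ^- n * (g * k).
  by rewrite expgnDr invgM -mulgA mulKg.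
by rewrite f2 addr0 => ->; rewrite [r ^+ n * _]mulgA -(cg n) -!mulgA mulKg.
Qed.

Lemma axis_edge e : e \in edges x 1 w -> A e.1 = sgb e.2.
Proof.
(* The successor makes the half-length positive, so that a copy of w begins at the midpoint of the
   segment. *)
move=> ew; have [n0 H] := A_lim e.1; rewrite -(H n0.+1 (leqnSn _)) /segment.
rewrite -rcl_wexp.
have -> : sgb e.2 = sgb (r ^+ n0.+1 * e.1, e.2).2 by [].
have -> : r ^+ n0.+1 * e.1 = (r ^+ n0.+1 * e.1, e.2).1 by [].
apply: fox_uniq => //; first exact: cmin_wexp_uniq.
rewrite wexpD edges_cat mem_cat rcl_wexp mul1g; apply/orP; right.
have -> : wexp w n0.+1 = w ++ wexp w n0 by [].
rewrite edges_cat mem_cat; apply/orP; left.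
have := edges_mull x (r ^+ n0.+1) 1 w; rewrite mulg1 => ->.
exact: (map_f (fun e => (r ^+ n0.+1 * e.1, e.2)) ew).
Qed.

(* Signed translation length along the axis of r, additive on the centralizer of r. *)
Definition shift g : int := integ x A 1 (rword g).

Lemma shift_rcl u : shift (rcl E u) = integ x A 1 u.
Proof.
by apply: integ_raag_eq => //; [apply: axis_invariant|apply: raag_eq_rword].
Qed.

Lemma shiftM g h : commute r g -> shift (g * h) = (shift g + shift h)%R.
Proof.
move=> rg; rewrite -(rwordK h) -{1}(rwordK g) -rclM !shift_rcl integ_cat rwordK.
congr (_ + _)%R; rewrite mul1g -[g]mulg1 integ_mull.
by apply: eq_bigr => e _; rewrite axis_centralizer.
Qed.

Lemma shift1 : shift 1 = 0%R.
Proof. by rewrite -rcl0 shift_rcl /integ big_nil. Qed.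

Lemma shiftX g n : commute r g -> shift (g ^+ n) = (shift g *+ n)%R.
Proof.
move=> rg; elim: n => [|n IH]; first by rewrite shift1.
by rewrite expgS shiftM // IH mulrS.
Qed.

Lemma shiftV g : commute r g -> shift g^-1 = (- shift g)%R.
Proof. by move=> rg; apply/eqP; rewrite -addr_eq0 addrC -shiftM // mulgV shift1. Qed.

Lemma shift_axis : (0 < shift r)%R.
Proof.
rewrite shift_rcl /integ big_seq (eq_bigr (fun=> 1%R)); last first.
  by move=> e ew; rewrite axis_edge //; case: e.2.
rewrite -big_seq big_const_seq count_predT iter_addr_0 ltr0n size_edges -has_count.
by move/mapP: xw => [l lw ->]; apply/hasP; exists l.
Qed.

(** The hyperplanes of the axis fall into finitely many orbits under r, as the pigeonhole argument
    of [centralizer_abelian] requires. *)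
Lemma axis_hyp k : A k != 0%R -> exists n m e, e \in edges x 1 w /\
  coset_rep x (r ^+ n * k) = coset_rep x (r ^+ m * e.1).
Proof.
have [n Hn] := A_lim k; rewrite -(Hn n) // /segment -rcl_wexp => Ak; exists n.
have {Ak} : coset_rep x (r ^+ n * k) \in hyps x 1 (wexp w (n + n)).
  by apply: contraNT Ak => /fox_notin ->.
elim: (n + n)%N => // m IH; rewrite wexpSr hyps_cat mem_cat => /orP[/IH //|].
rewrite rcl_wexp mul1g -[r ^+ m]mulg1 /hyps edges_mull -map_comp => /mapP[e ew ->].
by exists m, e.
Qed.

End Axis.

(** By [irr_split], one of two things happens. The support of the cyclic reduction of m contains
    that of w, hence x, and no conjugate of m avoids x; or it is both contained in the support of w
    and joined to it, hence empty. *)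
Lemma centralizer_elliptic m e : par (mem (unzip1 w)) m -> commute r m ->
  par (predC1 x) (m ^ e) -> m = 1.
Proof.
move=> sm rm xm; have [si [p [em csi ssi sp]]] := cmin_par_conj sm.
have com : commute (rcl E si) (r ^ p^-1).
  by apply: commute_sym; rewrite -(conjgK p (rcl E si)) -em; apply: conjg_commute.
have [S|S] := irr_split Esym Eirr csi cw iw com.
  have xsi := cmin_conj_par Esym Eirr cw S xw.
  have := cmin_conj_Npar Esym Eirr (p * e) csi xsi (ltn0Sn 0).
  by rewrite expg1 conjgM -em xm.
case: si => [|l si] in em csi ssi com S *; first by rewrite em rcl0 conj1g.
have lw : l.1 \in unzip1 w by move: ssi => /= /andP[].
have := cmin_conj_par Esym Eirr cw S lw; rewrite /lks /= => /andP[].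
by rewrite Eirr.
Qed.

(** The commutator k has translation length 0 and permutes the hyperplanes of the axis, which form
    finitely many orbits under r. So some r^N1 k^j1 and r^N2 k^j2 with j1 < j2 move one hyperplane
    to the same place, and they are equal by [centralizer_elliptic]. Then [shift] gives N1 = N2, and
    k is a torsion element. *)
Theorem centralizer_abelian g h : par (mem (unzip1 w)) g -> par (mem (unzip1 w)) h ->
  commute r g -> commute r h -> commute g h.
Proof.
move=> sg sh rg rh; apply/commgP/eqP; set k := [~ g, h].
have [A A_lim] := axis_exists.
have rk : commute r k.
  by rewrite /k /commg /conjg; do ?apply: commuteM => //; apply: commuteV.
have sk : par (mem (unzip1 w)) k by rewrite /k /commg /conjg !parM ?parV.
have k0 : shift A k = 0%R.
  rewrite /k /commg /conjg !shiftM //; try exact: commuteV.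
  by rewrite !shiftV // addrA -opprD addNr.
have [e0 e0w] : exists e0, e0 \in edges x (1 : raag E) w.
  have : 0 < size (edges x (1 : raag E) w).
    rewrite size_edges -has_count; move/mapP: xw => [l lw ->].
    by apply/hasP; exists l.
  by case: (edges x (1 : raag E) w) => // e0 s _; exists e0; apply: mem_head.
have crX j : commute r (k ^+ j) by apply: commuteX.
have Ak j : A (k ^+ j * e0.1) != 0%R.
  by rewrite (axis_centralizer A_lim) // (axis_edge A_lim) //; case: e0.2.
have hit j : exists p : nat * nat * (raag E * bool), p.2 \in edges x (1 : raag E) w /\
    coset_rep x (r ^+ p.1.1 * (k ^+ j * e0.1)) = coset_rep x (r ^+ p.1.2 * p.2.1).
  by have [n [m [e H]]] := axis_hyp A_lim (Ak j); exists (n, m, e).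
have [f Hf] := choice hit.
have [|j1 [j2 [j12 ef]]] := @pigeonhole_seq _ (fun j => (f j).2) (edges x (1 : raag E) w).
  by move=> j; have [] := Hf j.
pose N1 := ((f j2).1.2 + (f j1).1.1)%N; pose N2 := ((f j1).1.2 + (f j2).1.1)%N.
have same : coset_rep x (r ^+ N1 * k ^+ j1 * e0.1) = coset_rep x (r ^+ N2 * k ^+ j2 * e0.1).
  have [_ /eqP c1] := Hf j1; have [_ /eqP c2] := Hf j2.
  move: c1 c2; rewrite -(coset_rep_mull x (r ^+ (f j2).1.2)) => /eqP c1.
  rewrite -(coset_rep_mull x (r ^+ (f j1).1.2)) => /eqP c2.
  move: c1 c2; rewrite !mulgA -!expgnDr -/N1 -/N2 => -> ->.
  by rewrite addnC ef.
pose u1 := r ^+ N1 * k ^+ j1; pose u2 := r ^+ N2 * k ^+ j2.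
have ru1 : commute r u1 by apply: commuteM => //; apply: commuteX.
have ru2 : commute r u2 by apply: commuteM => //; apply: commuteX.
have u12 : u1^-1 * u2 = 1.
  apply: (@centralizer_elliptic _ e0.1).
  - by rewrite parM ?parV ?parM ?parX // par_supp.
  - by apply: commuteM => //; apply: commuteV.
  - apply: lk_predC1; move: same => /coset_repP; rewrite -/u1 -/u2.
    by rewrite invgM /conjg !mulgA.
have {u12} u12 : u1 = u2 by apply/esym/(mulgI u1^-1); rewrite mulVg.
have N12 : N1 = N2.
  have := congr1 (shift A) u12; rewrite /u1 /u2 !shiftM //; try exact: commuteX.
  rewrite !shiftX // k0 !mul0rn !addr0.
  by apply: mulrIn; apply: lt0r_neq0; apply: shift_axis.
apply: (@raag_torsion_free _ E Esym Eirr _ (j2 - j1)); first by rewrite subn_gt0.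
rewrite expgnFr 1?ltnW //; apply/eqP; rewrite divg_eq1; apply/eqP.
by move: u12; rewrite /u1 /u2 N12 => /mulgI.
Qed.

End Centralizer.

Lemma commute_conjV (G : groupType) (a b c : G) :
  commute (a ^ c) b <-> commute a (b ^ c^-1).
Proof.
split=> [/(@conjg_commute _ _ _ c^-1)|/(@conjg_commute _ _ _ c)].
  by rewrite conjgK.
by rewrite conjgKV.
Qed.

Lemma eventually_all (I : finType) (P : I -> nat -> Prop) :
  (forall i, exists K, forall k, K <= k -> P i k) ->
  exists K, forall k, K <= k -> forall i, P i k.
Proof.
move=> /choice[f Hf]; exists (\max_i f i) => k le i; apply: Hf.
by apply: leq_trans le; apply: leq_bigmax.
Qed.

(** * Replacing blocks by conjugates of vertices *)

Section Blocks.
Variables (V : finType) (E : rel V).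
Hypotheses (Esym : symmetric E) (Eirr : irreflexive E).
Implicit Types (g h f : raag E) (x y : V).

(** The retraction onto <star y> kills s and fixes both f and its conjugate by s^k, so these two are
    equal. *)
Lemma commute_star_retract y s f k : ~~ star E y s -> 0 < k ->
  commute f (gen E y) -> commute (f ^ (gen E s ^+ k)) (gen E y) -> commute f (gen E s).
Proof.
move=> ys k0 fy fky.
have /parP pf : par (star E y) f.
  by apply: (@commute_gen_star _ E Esym Eirr y 1) => //; apply: commute_sym.
have /parP : par (star E y) (f ^ (gen E s ^+ k)).
  by apply: (@commute_gen_star _ E Esym Eirr y 1) => //; apply: commute_sym.
rewrite retrJ retrX pf retr_rcl /wfilter /= (negbTE ys) rcl0 expg1n conjg1 => e.
apply: commute_sym; apply: (@commute_genX _ E Esym Eirr s k) => //; apply: commute_sym.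
by apply/commgP/conjg_fixP.
Qed.

(** If s is outside the star of y, at most one exponent makes the conjugate commute with y: two
    would force f to commute with s, hence with y. *)
Lemma Ncommute_eventually y s f : ~ commute f (gen E y) ->
  exists K, forall k, K <= k -> ~ commute (f ^ (gen E s ^+ k)) (gen E y).
Proof.
move=> fy; have [ys|ys] := boolP (star E y s).
  exists 0 => k _ /commute_conjV; rewrite (@commute_conjg _ (gen E y)) //.
  apply: commuteV; apply: commuteX; apply: star_commute => //.
  exact: par_gen.
have [[k0 ck0]|N] := pselect (exists k0, commute (f ^ (gen E s ^+ k0)) (gen E y)); last first.
  by exists 0 => k _ ck; apply: N; exists k.
exists k0.+1 => k kk0 ck; apply: fy.
have : commute (f ^ (gen E s ^+ k0)) (gen E s).
  apply: (@commute_star_retract y s _ (k - k0)) => //; first by rewrite subn_gt0.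
  by rewrite -conjgM -expgnDr subnKC // ltnW.
move=> /commute_conjV; rewrite (@commute_conjg _ (gen E s)); last first.
  by apply: commuteV; apply: commuteX.
by move=> fs; rewrite (@commute_conjg _ f) in ck => //; apply: commuteX.
Qed.

(* Conjugation by s^k, for k large, preserves non-commutation with each vertex, and
   spreads it from s to the vertices not adjacent to s. *)
Lemma generic_conj (S : seq V) (J : finType) (F : J -> raag E) : irr E S ->
  (forall j, exists2 y, y \in S & ~ commute (F j) (gen E y)) ->
  exists2 h, par (mem S) h & forall j y, y \in S -> ~ commute (F j ^ h) (gen E y).
Proof.
move=> iS; pose bad (F : J -> raag E) := [set p : J * V |
  (p.2 \in S) && `[< commute (F p.1) (gen E p.2) >]].
have [n] := ubnP #|bad F|; elim: n F => // n IH F Fn HF.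
have [b0|/set0Pn[[j0 y0]]] := eqVneq (bad F) set0.
  exists 1; first exact: par1.
  move=> j y yS; rewrite conjg1 => c.
  have : (j, y) \in bad F by rewrite inE /= yS; apply/asboolP.
  by rewrite b0 inE.
rewrite inE /= => /andP[y0S /asboolP c0].
(* Irreducibility yields nonadjacent s and y in S such that F j0 commutes with y but not with s;
   conjugation by a power of s then repairs the pair (j0, y). *)
have [||s [y [sS yS /asboolP Ns /asboolPn/contrapT cy Nsy]]] :=
    iS (fun y => `[< ~ commute (F j0) (gen E y) >]).
- by have [y yS Ny] := HF j0; apply/hasP; exists y => //; apply/asboolP.
- by apply/hasP; exists y0 => //=; apply/asboolPn => /(_ c0).
have ys : ~~ star E y s.
  rewrite /star negb_or Esym Nsy andbT; apply: contra_notN Ns => /eqP ->.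
  exact: cy.
pose Fk k j := F j ^ (gen E s ^+ k).
have [K HK] : exists K, forall k, K <= k ->
    forall p : J * V, p \notin bad F -> p \notin bad (Fk k).
  apply: eventually_all => -[j z]; have [zS|zS] := boolP (z \in S); last first.
    by exists 0 => k _ _; rewrite inE /= (negbTE zS).
  have [cz|/(Ncommute_eventually s)[K HK]] := pselect (commute (F j) (gen E z)).
    by exists 0 => k _; rewrite inE /= zS; move/asboolP: cz => ->.
  exists K => k /HK Nk _; rewrite inE /= zS; exact/asboolPn.
have sub : bad (Fk K.+1) \proper bad F.
  apply/properP; split.
    by apply/subsetP => p; apply: contraTT; apply: HK; apply: leqnSn.
  exists (j0, y); first by rewrite inE /= yS; apply/asboolP.
  rewrite inE /= yS; apply/asboolPn => c; apply: Ns.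
  exact: (commute_star_retract ys (ltn0Sn K) cy c).
have [||h Sh Hh] := IH (Fk K.+1).
- by apply: leq_trans (proper_card sub) _.
- move=> j; have [z zS Nz] := HF j; exists z => //.
  have : (j, z) \notin bad (Fk K.+1).
    by apply: HK => //; rewrite inE /= zS; apply/asboolPn.
  by rewrite inE /= zS => /asboolPn.
exists (gen E s ^+ K.+1 * h); first by rewrite parM // parX // par_gen.
by move=> j z zS; rewrite conjgM; apply: Hh.
Qed.

(* The block (w, g) stands for the element g^-1 w g, and [inP] for membership in
   its parabolic closure <supp w>^g. *)
Definition block := (word V * raag E)%type.
Implicit Types (b c : block).
Definition blk b : raag E := rcl E b.1 ^ b.2.
Definition isblock b := [/\ cmin E b.1, irr E (unzip1 b.1) & b.1 != [::]].
Definition inP b h := par (mem (unzip1 b.1)) (h ^ b.2^-1).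
Definition perp b c := forall h h', inP b h -> inP c h' -> commute h h'.
Definition sameP b c := forall h, inP b h = inP c h.

Lemma inP_blk b : inP b (blk b).
Proof. by rewrite /inP /blk conjgK par_supp. Qed.

Lemma perp_sym b c : perp b c -> perp c b.
Proof. by move=> p h h' hc hb; apply/commute_sym/p. Qed.

(** By [irr_split] in both directions, unless the parabolic closures commute, each contains the
    other. *)
Lemma blocks_commute b c : isblock b -> isblock c -> commute (blk b) (blk c) ->
  perp b c \/ sameP b c.
Proof.
have half b' c' : isblock b' -> isblock c' -> commute (blk b') (blk c') ->
    perp b' c' \/ forall h, inP c' h -> inP b' h.
  case: b' c' => [w1 g1] [w2 g2] [/= c1 i1 n1] [/= c2 i2 n2]; rewrite /blk /= => com.
  have {}com : commute (rcl E w1) (rcl E w2 ^ (g2 / g1)).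
    by rewrite conjgM; apply/commute_conjV.
  have [S|S] := irr_split Esym Eirr c1 c2 i2 com; [right|left].
    move=> h; rewrite /inP /= => Ph.
    by have := parabolic_closure Esym Eirr c2 S Ph; rewrite conjgM conjgKV.
  move=> h h'; rewrite /inP /= => Ph /(parabolic_closure Esym Eirr c2 S).
  rewrite conjgM conjgKV => Lh'; rewrite -(conjgKV g1 h) -(conjgKV g1 h').
  by apply: conjg_commute; apply: lks_commute Ph Lh'.
move=> Bb Bc com; have [|cb] := half _ _ Bb Bc com; first by left.
have [/perp_sym|bc] := half _ _ Bc Bb (commute_sym com); first by left.
by right=> h; apply/idP/idP; [apply: bc | apply: cb].
Qed.

Definition bsim b c := sameP b c /\ commute (blk b) (blk c).

Lemma bsim_refl b : bsim b b. Proof. by split. Qed.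
Lemma bsim_sym b c : bsim b c -> bsim c b.
Proof. by move=> [bc com]; split=> // h; rewrite bc. Qed.
(** Commutation is transitive here because the centralizer of a block in its own parabolic closure
    is abelian. *)
Lemma bsim_trans b c d : isblock c -> bsim b c -> bsim c d -> bsim b d.
Proof.
move=> [cc ic nc] [bc cbc] [cd ccd]; split; first by move=> h; rewrite bc cd.
have Pb : inP c (blk b) by rewrite -bc inP_blk.
have Pd : inP c (blk d) by rewrite cd inP_blk.
case: c => [w g] /= in cc ic nc cbc ccd Pb Pd {bc cd} *.
rewrite -(conjgKV g (blk b)) -(conjgKV g (blk d)); apply: conjg_commute.
have [x xw] : exists x, x \in unzip1 w.
  by case: w nc {cc ic cbc ccd Pb Pd} => // l w _; exists l.1; rewrite mem_head.
apply: (centralizer_abelian Esym Eirr cc ic xw Pb Pd).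
- by rewrite -(conjgK g (rcl E w)); apply: conjg_commute; apply: commute_sym.
- by rewrite -(conjgK g (rcl E w)); apply: conjg_commute.
Qed.

Lemma perp_same b c b' c' : sameP b b' -> sameP c c' -> perp b c -> perp b' c'.
Proof. by move=> bb' cc' p h h'; rewrite -bb' -cc'; apply: p. Qed.

Lemma generic_vertex b v (F : seq (raag E)) : isblock b -> v \in unzip1 b.1 ->
  (forall f, f \in F -> exists2 p, inP b p & ~ commute f p) ->
  exists2 k, par (mem (unzip1 b.1)) (k / b.2) &
    forall f, f \in F -> ~ commute f (gen E v ^ k).
Proof.
case: b => w g [/= cw iw nw] vw HF.
have [|h Sh Hh] := @generic_conj (unzip1 w) _ (fun j : 'I_(size F) => F`_j ^ g^-1) iw.
  move=> j; have [p Pp Np] := HF _ (mem_nth 1 (ltn_ord j)).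
  apply: contra_notP Np => N.
  rewrite -(conjgKV g (F`_j)) -(conjgKV g p); apply: conjg_commute.
  apply: commute_sym; apply: (par_commute _ Pp) => y yw; apply: commute_sym.
  by apply: contra_notP N => Ny; exists y.
exists (h^-1 * g); first by rewrite mulgK parV.
move=> f /(nthP 1)[j jF <-] c; apply: (Hh (Ordinal jF) v vw) => /=.
by rewrite -conjgM commute_conjV invgM invgK.
Qed.

Lemma inP_vertex b v k : v \in unzip1 b.1 -> par (mem (unzip1 b.1)) (k / b.2) ->
  inP b (gen E v ^ k).
Proof. by move=> vb kb; rewrite /inP -conjgM parJ // par_gen. Qed.

(** A vertex conjugate common to two commuting closures is central in both. By irreducibility each
    support is then a single vertex, and both closures are the cyclic group generated by that
    conjugate. *)
Lemma vertex_perp_eq b c v v' (k k' : raag E) : isblock b -> isblock c ->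
  v \in unzip1 b.1 -> par (mem (unzip1 b.1)) (k / b.2) ->
  v' \in unzip1 c.1 -> par (mem (unzip1 c.1)) (k' / c.2) ->
  perp b c -> gen E v ^ k = gen E v' ^ k' -> bsim b c.
Proof.
have half b' c' v1 v2 (k1 k2 : raag E) : isblock b' ->
    v1 \in unzip1 b'.1 -> par (mem (unzip1 b'.1)) (k1 / b'.2) ->
    v2 \in unzip1 c'.1 -> par (mem (unzip1 c'.1)) (k2 / c'.2) ->
    perp b' c' -> gen E v1 ^ k1 = gen E v2 ^ k2 -> forall h, inP b' h -> inP c' h.
  move=> Bb v1b k1b v2c k2c pbc e.
  have Pe : inP c' (gen E v1 ^ k1) by rewrite e inP_vertex.
  have com y : y \in unzip1 b'.1 -> commute (gen E v1) (gen E y).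
    move=> yb; rewrite -(conjgK k1 (gen E v1)) -(conjgK k1 (gen E y)).
    by apply/conjg_commute/commute_sym/pbc => //; apply: inP_vertex.
  have sing y : y \in unzip1 b'.1 -> y = v1.
    move=> yb; apply/eqP; apply: contraT => yv; case: Bb => _ ib _.
    have [||t [u [tb ub /eqP -> uv]]] := ib (pred1 v1).
    - by apply/hasP; exists v1 => /=.
    - by apply/hasP; exists y.
    by rewrite (commute_gen Esym Eirr (com _ ub)) // eq_sym.
  move=> h Ph; rewrite -(conjgKV b'.2 h).
  have cc (q q' : raag E) : par (mem (unzip1 b'.1)) q ->
      par (mem (unzip1 b'.1)) q' -> commute q q'.
    move=> sq sq'; apply: (par_commute _ sq) => y /sing ->; apply: commute_sym.
    by apply: (par_commute _ sq') => z /sing ->.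
  have -> : (h ^ b'.2^-1) ^ b'.2 = (h ^ b'.2^-1) ^ k1.
    by rewrite -[k1](mulgVK b'.2) conjgM (commute_conjg (cc _ _ Ph k1b)).
  move: Ph; rewrite /inP => /par_word[w -> /allP bw].
  elim: w bw => [|[y e'] w IH] bw; first by rewrite rcl0 !conj1g par1.
  rewrite rcl_cons (conjMg _ _ k1) (conjMg _ _ c'.2^-1) parM //; last first.
    by apply: IH => l lw; apply: bw; rewrite inE lw orbT.
  have -> : y = v1 by apply: sing; apply: (bw (y, e')); apply: mem_head.
  by case: e' {bw}; rewrite /lt /= ?conjVg ?parV.
move=> Bb Bc vb kb vc kc p e; split; last by apply: p; apply: inP_blk.
move=> h; apply/idP/idP; first exact: (half b c v v' k k').
by apply: (half c b v' v k' k) => //; apply: perp_sym.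
Qed.

(** The conjugators are chosen one index at a time, each generic with respect to finitely many
    elements that its vertex must not commute with. One index of each class of [bsim] then serves
    the whole class. *)
Lemma vertex_system (T : finType) (B : T -> block) : (forall i, isblock (B i)) ->
  exists (v : T -> V) (k : T -> raag E), let c i := gen E (v i) ^ k i in
    [/\ forall i j, bsim (B i) (B j) -> v i = v j /\ k i = k j,
        forall i j, ~ bsim (B i) (B j) -> c i <> c j
      & forall i j, ~ bsim (B i) (B j) ->
          (commute (c i) (c j) <-> commute (blk (B i)) (blk (B j)))].
Proof.
move=> BB; have exv i : exists x, x \in unzip1 (B i).1.
  by case: (BB i) => _ _; case: (B i).1 => // l w _; exists l.1; rewrite mem_head.
have [v vB] := choice exv.
pose c (k : T -> raag E) i := gen E (v i) ^ k i.
pose ok (k : T -> raag E) i := par (mem (unzip1 (B i).1)) (k i / (B i).2).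
have [k [okk Hk]] : exists k, (forall i, ok k i) /\
    forall i j, i != j -> ~ perp (B i) (B j) -> ~ commute (c k i) (c k j).
  (* The last clause keeps the induction going: a vertex already chosen does not centralize the
     closure of any block that is not perpendicular to its own, so later choices can avoid commuting
     with it. *)
  suff [k [Hok Hcom Hp]] : exists k, [/\ forall i, i \in enum T -> ok k i,
      forall i j, i \in enum T -> j \in enum T -> i != j ->
        ~ perp (B i) (B j) -> ~ commute (c k i) (c k j) &
      forall i j, i \in enum T -> ~ perp (B i) (B j) ->
        exists2 p, inP (B j) p & ~ commute (c k i) p].
    by exists k; split=> [i|i j]; [apply: Hok|apply: Hcom]; rewrite mem_enum.
  elim: (enum T) => [|i s [k [Hok Hcom Hp]]]; first by exists (fun=> 1); split.
  have [ins|ins] := boolP (i \in s).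
    exists k; split=> [j|j l|j l]; rewrite ?inE => /predU1P[->|js]; auto.
    - by move=> /predU1P[->|ls]; [rewrite eqxx | apply: Hcom].
    - by move=> /predU1P[->|ls]; apply: Hcom.
  have Hq j : exists q, ~ perp (B i) (B j) ->
      inP (B j) q /\ exists2 p, inP (B i) p & ~ commute q p.
    have [p|Np] := pselect (perp (B i) (B j)); first by exists 1.
    have [q Hq] : exists q, inP (B j) q /\ exists2 p, inP (B i) p & ~ commute q p.
      apply: contra_notP Np => N h h' Ph Ph'; apply: contra_notP N => Nc.
      by exists h'; split=> //; exists h => // /commute_sym.
    by exists q.
  have [q {}Hq] := choice Hq.
  pose F := [seq c k j | j <- s & `[< ~ perp (B i) (B j) >]] ++
    [seq q j | j <- enum T & `[< ~ perp (B i) (B j) >]].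
  have [|ki oki Hki] := @generic_vertex (B i) (v i) F (BB i) (vB i).
    move=> f; rewrite mem_cat => /orP[] /mapP[j];
      rewrite mem_filter => /andP[/asboolP Np js] ->.
      by apply: Hp => // /perp_sym.
    by have [] := Hq j Np.
  pose k' j := if j == i then ki else k j.
  have k'i : k' i = ki by rewrite /k' eqxx.
  have k's j : j \in s -> k' j = k j.
    by move=> js; rewrite /k'; case: eqP => // ji; rewrite -ji js in ins.
  have Ncs j : j \in s -> ~ perp (B i) (B j) -> ~ commute (c k' i) (c k' j).
    move=> js Np; rewrite /c k'i k's // => /commute_sym; apply: Hki.
    rewrite mem_cat; apply/orP; left; apply/mapP; exists j => //.
    by rewrite mem_filter js andbT; apply/asboolP.
  exists k'; split=> [j|j l|j l]; rewrite !inE.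
  - by move=> /predU1P[->|js]; rewrite /ok ?k'i // k's //; apply: Hok.
  - move=> /predU1P[->|js] /predU1P[->|ls]; rewrite ?eqxx // => jl Np.
    + exact: Ncs.
    + by move=> /commute_sym; apply: Ncs => // /perp_sym.
    + by rewrite /c !k's //; apply: Hcom.
  - move=> /predU1P[->|js] Np; last by rewrite /c k's //; apply: Hp.
    exists (q l); first by have [] := Hq l Np.
    rewrite /c k'i => /commute_sym; apply: Hki; rewrite mem_cat; apply/orP; right.
    by apply/mapP; exists l; rewrite // mem_filter mem_enum andbT; apply/asboolP.
pose sim i j := `[< bsim (B i) (B j) >].
pose rep i := choose (sim i) i.
have simrr i : sim i i by apply/asboolP/bsim_refl.
have repP i : bsim (B i) (B (rep i)) by apply/asboolP/(chooseP (simrr i)).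
have rep_eq i j : bsim (B i) (B j) -> rep i = rep j.
  move=> ij; rewrite /rep (@eq_choose _ (sim i) (sim j)).
    by apply: choose_id => //; apply/asboolP/bsim_sym.
  move=> l; apply/asboolP/asboolP; first exact/bsim_trans/bsim_sym.
  exact: bsim_trans ij.
have rep_neq i j : ~ bsim (B i) (B j) -> rep i != rep j.
  apply: contra_notN => /eqP e; apply: bsim_trans (repP i) _ => //.
  by rewrite e; apply/bsim_sym.
have perp_rep i j : perp (B (rep i)) (B (rep j)) -> perp (B i) (B j).
  by apply: perp_same; apply: (proj1 (bsim_sym (repP _))).
exists (v \o rep), (k \o rep); split=> [i j ij|i j ij e|i j ij].
- by rewrite /= (rep_eq i j).
- have [p|Np] := pselect (perp (B (rep i)) (B (rep j))).
    by case: ij; apply: bsim_trans (repP i) _ => //;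
      apply: bsim_trans (bsim_sym (repP j)) => //;
      apply: (vertex_perp_eq _ _ (vB _) (okk _) (vB _) (okk _) p e).
  by case: (Hk _ _ (rep_neq _ _ ij) Np); rewrite /c; rewrite /= in e; rewrite e.
- have [p|Np] := pselect (perp (B (rep i)) (B (rep j))).
    split=> _; last by apply: p; apply: inP_vertex (vB _) (okk _).
    by apply: (perp_rep _ _ p); apply: inP_blk.
  split=> [/(Hk _ _ (rep_neq _ _ ij) Np) //|com].
  have [p|sp] := blocks_commute (BB i) (BB j) com; last by case: ij.
  by case: Np; apply: perp_same p; apply: (proj1 (repP _)).
Qed.

End Blocks.

Lemma ev_rlift (V V' : choiceType) (E : rel V') (H : groupType) (f : V -> raag E)
    (y : V' -> H) w : (forall a b, E a b -> commute (y a) (y b)) ->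
  ev (fun v => rlift y (f v)) w = rlift y (ev f w).
Proof.
move=> yE; elim: w => [|l w IH]; first by rewrite /ev !big_nil rlift1.
rewrite !ev_cons IH rliftM //; congr (_ * _).
by case: l.2; rewrite // rliftV.
Qed.

Lemma rliftX (V : choiceType) (E : rel V) (H : groupType) (y : V -> H) (g : raag E) n :
  (forall a b, E a b -> commute (y a) (y b)) -> rlift y (g ^+ n) = rlift y g ^+ n.
Proof. by move=> yE; elim: n => [|n IH]; rewrite ?rlift1 // !expgS rliftM // IH. Qed.

Lemma rliftJ (V : choiceType) (E : rel V) (H : groupType) (y : V -> H) (g h : raag E) :
  (forall a b, E a b -> commute (y a) (y b)) -> rlift y (g ^ h) = rlift y g ^ rlift y h.
Proof. by move=> yE; rewrite /conjg !rliftM // rliftV. Qed.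

Lemma eq_ev (V : choiceType) (H : groupType) (f f' : V -> H) : f =1 f' -> ev f =1 ev f'.
Proof. by move=> ff' w; apply: eq_bigr => l _; rewrite ff'. Qed.

(** * Embeddings by conjugates of powers of vertices *)

Section Emb.
Variables (V V' : finType) (E : rel V) (E' : rel V').

Definition ygrp (d : word V' * V' * nat) : raag E' :=
  (gen E' d.1.2 ^+ d.2) ^ rcl E' d.1.1.

(** This shape of embedding is closed under composition, and each image is a single factor of the
    tame form. *)
Definition emb_data (d : V -> word V' * V' * nat) :=
  [/\ forall v, 0 < (d v).2,
      forall a b, E a b -> commute (ygrp (d a)) (ygrp (d b)) &
      forall u w, ev (ygrp \o d) u = ev (ygrp \o d) w -> rcl E u = rcl E w].

Definition emb := exists d, emb_data d.

Lemma emb_inj d g h : emb_data d -> rlift (ygrp \o d) g = rlift (ygrp \o d) h ->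
  g = h :> raag E.
Proof. by move=> [_ _ inj] /inj; rewrite !rwordK. Qed.

Lemma emb_induced (f : V -> V') : injective f ->
  (forall a b, E' (f a) (f b) = E a b) -> emb.
Proof.
move=> finj fE; exists (fun v => ([::], f v, 1%N)).
pose y v := gen E' (f v).
have yE : ygrp \o (fun v => ([::], f v, 1%N)) =1 y.
  by move=> v; rewrite /ygrp /= rcl0 conjg1 expg1.
split=> // [a b ab|u w].
  by rewrite -!/((ygrp \o (fun v => ([::], f v, 1%N))) _) !yE; apply: gen_commute; rewrite fE.
rewrite !(eq_ev yE).
pose z v' := if [pick v | f v == v'] is Some v then gen E v else 1.
have zf v : z (f v) = gen E v.
  rewrite /z; case: pickP => [v0 /eqP/finj -> //|/(_ v)].
  by rewrite eqxx.
have zE a b : E' a b -> commute (z a) (z b).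
  rewrite /z; case: pickP => [v1 /eqP <-|_ _]; last exact/commute_sym/commute1.
  by case: pickP => [v2 /eqP <-|_ _]; [rewrite fE; apply: gen_commute | exact: commute1].
have red u0 : rlift z (ev y u0) = rcl E u0.
  rewrite -ev_rlift // -ev_gen; apply: eq_ev => v.
  by rewrite /y rlift_gen // zf.
by move=> /(congr1 (rlift z)); rewrite !red.
Qed.

End Emb.

Lemma emb_trans (V1 V2 V3 : finType) (E1 : rel V1) (E2 : rel V2) (E3 : rel V3) :
  emb E1 E2 -> emb E2 E3 -> emb E1 E3.
Proof.
move=> [d1 D1] [d2 D2]; pose y1 := ygrp E2 \o d1; pose y2 := ygrp E3 \o d2.
have [p1 c1 i1] := D1; have [p2 c2 i2] := D2.
pose d v := ((d2 (d1 v).1.2).1.1 ++ rword (rlift y2 (rcl E2 (d1 v).1.1)),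
  (d2 (d1 v).1.2).1.2, ((d2 (d1 v).1.2).2 * (d1 v).2)%N).
have yd : ygrp E3 \o d =1 (fun v => rlift y2 (y1 v)).
  move=> v; rewrite /y1 /d /= /ygrp /= rliftJ // rliftX // rlift_gen // rclM rwordK.
  by rewrite conjgM expgnA -conjXg.
exists d; split.
- by move=> v; rewrite /d /= muln_gt0 p1 p2.
- move=> a b ab; rewrite -!/((ygrp E3 \o d) _) !yd /commute -!rliftM //.
  by congr rlift; apply: c1.
- by move=> u w; rewrite !(eq_ev yd) !ev_rlift // => /(emb_inj D2) /i1.
Qed.

(** * Doubles along a star as subgroups of finite index *)

Section Double.
Variables (V : finType) (E : rel V) (v : V) (m : nat).
Hypothesis (Esym : symmetric E).
Notation st := (star E v).

(* The vertices of the (m+1)-fold double of E along the star of v: the vertices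
   outside the star have m+1 copies, the others only the copy of index 0. *)
Definition dpred (p : V * 'I_m.+1) := st p.1 ==> (p.2 == ord0).
Definition dtype := {p : V * 'I_m.+1 | dpred p}.
HB.instance Definition _ := Finite.on dtype.

Fact dvert_subproof (u : V) (i : 'I_m.+1) :
  dpred (u, if st u then ord0 else i).
Proof. by rewrite /dpred /=; case: (st u). Qed.
Definition dvert u i : dtype := Sub (u, if st u then ord0 else i) (dvert_subproof u i).

Lemma dvertK (p : dtype) : dvert (val p).1 (val p).2 = p.
Proof.
apply: val_inj => /=; case: p => -[u i] /=; rewrite /dpred /=.
by case: (st u) => //= /eqP ->.
Qed.

Lemma dvert_star u i j : st u -> dvert u i = dvert u j.
Proof. by move=> su; apply: val_inj; rewrite /= su. Qed.

Definition drel : rel dtype := fun p q =>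
  (st (val p).1 || st (val q).1 || ((val p).2 == (val q).2)) && E (val p).1 (val q).1.

Lemma drel_sym : symmetric drel.
Proof. by move=> p q; rewrite /drel Esym (orbC (st _)) (eq_sym (val p).2). Qed.

Lemma drel_irr : irreflexive E -> irreflexive drel.
Proof. by move=> Eirr p; rewrite /drel Eirr andbF. Qed.

Lemma drel_dvert a b i : E a b -> drel (dvert a i) (dvert b i).
Proof. by rewrite /drel /= => ->; case: (st a); case: (st b); rewrite //= eqxx. Qed.

(** The copy (u, i) stands for u conjugated by v^i, and v for v^(m+1): generators of the kernel of
    the exponent of v modulo m+1. *)
Definition ddata (p : dtype) : word V * V * nat :=
  (nseq (val p).2 (v, false), (val p).1, if (val p).1 == v then m.+1 else 1%N).
Notation th := (ygrp E \o ddata).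

Lemma rcl_nseq n : rcl E (nseq n (v, false)) = gen E v ^+ n.
Proof. by elim: n => [|n IH]; rewrite //= rcl_cons IH expgS. Qed.

Lemma star_conj u j : st u -> gen E u ^ (gen E v ^+ j) = gen E u.
Proof.
move=> su; apply: commute_conjg; apply: commuteX; apply: commute_sym.
by apply: star_commute; apply: par_gen.
Qed.

Lemma ddata_dvert u i :
  th (dvert u i) = (gen E u ^+ (if u == v then m.+1 else 1%N)) ^ (gen E v ^+ i).
Proof.
rewrite /= /ygrp /= rcl_nseq; case: (boolP (st u)) => // su.
by rewrite /= conjg1 conjXg star_conj.
Qed.

Lemma ddata_commute p q : drel p q -> commute (th p) (th q).
Proof.
have aux a b i : E a b -> commute (th (dvert a i)) (th (dvert b i)).
  move=> ab; rewrite !ddata_dvert; apply: conjg_commute; apply: commuteX.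
  by apply/commute_sym/commuteX/commute_sym/gen_commute.
rewrite -(dvertK p) -(dvertK q); move: (val p) (val q) => [a i] [b j].
rewrite /drel => /= /andP[H ab].
case: (boolP (st a)) H => [sa _|_]; first by rewrite (dvert_star i j sa); apply: aux.
case: (boolP (st b)) => [sb _|_ /= /eqP ->]; last exact: aux.
by rewrite (dvert_star j i sb); apply: aux.
Qed.

Notation state := (raag drel * 'I_m.+1)%type.
Notation dv := (dvert v ord0).

(* The group of E acts on the right of raag drel x Z/(m+1) so that th w translates
   the fibre over 0 by w; it is the action induced from a subgroup of index m+1. *)
Definition dstep (s : state) (l : letter V) : state :=
  if l.1 == v then
    if l.2 then ((if s.2 == ord_max then s.1 / gen drel dv else s.1), ordS s.2)
    else ((if s.2 == ord0 then s.1 * gen drel dv else s.1), ord_pred s.2)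
  else (s.1 * lt drel (dvert l.1 s.2, l.2), s.2).

Definition dact (w : word V) (s : state) : state := foldl dstep s w.

Lemma dact_cat u w s : dact (u ++ w) s = dact w (dact u s).
Proof. exact: foldl_cat. Qed.

Lemma ordS_max : ordS (ord_max : 'I_m.+1) = ord0.
Proof. by apply: val_inj; rewrite /= modnn. Qed.

Lemma ordS_eq0 (i : 'I_m.+1) : (ordS i == ord0) = (i == ord_max).
Proof. by rewrite -ordS_max; apply: (inj_eq (can_inj (@ordSK _))). Qed.

Lemma ord_pred_max (i : 'I_m.+1) : (ord_pred i == ord_max) = (i == ord0).
Proof. by rewrite -ordS_eq0 ord_predK. Qed.

Lemma star_v : st v. Proof. by rewrite /star eqxx. Qed.

Lemma dact_raag_eq u w s : raag_eq E u w -> dact u s = dact w s.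
Proof.
move=> uw; elim: uw s => {u w} [a x y b xy|a|a b _ IH|a b d _ IH _ IH'] s //;
  last by rewrite IH.
rewrite !dact_cat; congr dact; move: (dact a s) => {}s.
case: xy => [u c|a' b' ab]; rewrite /dact /= /dstep /=; case: s => g i /=.
  have [_|uv] := eqVneq u v; last by rewrite -mulgA ltN mulgV mulg1.
  case: c => /=.
    by rewrite ordS_eq0 ordSK; case: (i == ord_max); rewrite ?mulgVK.
  by rewrite ord_pred_max ord_predK; case: (i == ord0); rewrite ?mulgK.
have [av|av] := eqVneq a' v; have [bv|bv] := eqVneq b' v => //=.
- have sb : st b' by rewrite /star -av ab orbT.
  rewrite (dvert_star i ord0 sb) (dvert_star (ord_pred i) ord0 sb) /lt /=.
  congr (_, _); case: (i == ord0) => //; rewrite -!mulgA; congr (_ * _).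
  by apply: gen_commute; apply: drel_dvert; rewrite -av.
- have sa : st a' by rewrite /star -bv Esym ab orbT.
  rewrite (dvert_star i ord0 sa) (dvert_star (ord_pred i) ord0 sa) /lt /=.
  congr (_, _); case: (i == ord0) => //; rewrite -!mulgA; congr (_ * _).
  by apply: gen_commute; apply: drel_dvert; rewrite -bv.
- rewrite /lt /= -!mulgA; congr (_ * _, _).
  by apply: gen_commute; apply: drel_dvert.
Qed.

Definition dactg (h : raag E) (s : state) := dact (rword h) s.

Lemma dactg_rcl w s : dactg (rcl E w) s = dact w s.
Proof. exact/dact_raag_eq/raag_eq_rword. Qed.

Lemma dactgM g h s : dactg (g * h) s = dactg h (dactg g s).
Proof. by rewrite -(rwordK g) -(rwordK h) -rclM !dactg_rcl dact_cat. Qed.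

Lemma dactg1 s : dactg 1 s = s.
Proof. by rewrite -rcl0 dactg_rcl. Qed.

Lemma dactgV h s s' : dactg h s = s' -> dactg h^-1 s' = s.
Proof. by move=> <-; rewrite -dactgM mulgV dactg1. Qed.

Lemma dactg_gen u s : dactg (gen E u) s = dstep s (u, false).
Proof. by rewrite dactg_rcl. Qed.

Lemma dactg_down (n : nat) (i : 'I_m.+1) g : n = i -> dactg (gen E v ^+ n) (g, i) = (g, ord0).
Proof.
elim: n i => [|n IH] i ni.
  by rewrite dactg1; congr (_, _); apply: val_inj.
rewrite expgS dactgM dactg_gen /dstep /= eqxx.
have -> : i == ord0 = false by rewrite -val_eqE /= -ni.
apply: IH; rewrite /= -ni addSn /= modnDr modn_small //.
by rewrite ltnW // ni ltn_ord.
Qed.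

(** For u other than v, v^-i leads from index 0 to i, u multiplies by its copy of index i, and v^i
    leads back. For v, the m+1 steps make a full turn, which multiplies only once, on leaving index
    0. *)
Lemma dactg_th p g : dactg (th p) (g, ord0) = (g * gen drel p, ord0).
Proof.
rewrite -(dvertK p); move: (val p) => [u i] /=; rewrite -[ygrp _ _]/(th _) ddata_dvert.
have down := @dactg_down i i _ erefl.
have [uv|uv] := eqVneq u v.
  rewrite uv conjXg star_conj ?star_v // expgS dactgM dactg_gen /dstep /= eqxx.
  rewrite (dvert_star i ord0 star_v).
  have -> : ord_pred (ord0 : 'I_m.+1) = ord_max by apply/eqP; rewrite ord_pred_max.
  exact: dactg_down.
rewrite /conjg expg1 !dactgM (dactgV (down g)) dactg_gen /dstep /= (negbTE uv).
by rewrite /lt /= down.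
Qed.

(** Injectivity holds because the image of an element g of the double moves (1, 0) to (g, 0). *)
Lemma ddata_emb : emb_data drel E ddata.
Proof.
split.
- by move=> p; rewrite /=; case: ifP.
- exact: ddata_commute.
have act u g : dactg (ev th u) (g, ord0) = (g * rcl drel u, ord0).
  elim: u g => [|[p b] u IH] g; first by rewrite /ev big_nil dactg1 mulg1.
  rewrite ev_cons dactgM rcl_cons mulgA -IH; congr dactg.
  case: b; rewrite /lt; last exact: dactg_th.
  by apply: dactgV; rewrite dactg_th mulgVK.
move=> u w e; have := act w 1; rewrite -e act !mul1g.
by case.
Qed.

End Double.

Section Unwind.
Variables (V : finType) (E : rel V) (v : V) (m : nat).
Hypotheses (Esym : symmetric E) (Eirr : irreflexive E).
Notation th := (ygrp E \o @ddata V E v m).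
Notation dE := (@drel V E v m).

(** The power v^B is pushed leftwards through k: a letter v changes the exponent, and any other
    letter u becomes the vertex of the double that stands for u conjugated by the current power of
    v. The bounds keep the exponent between 0 and 2B, so that it is the index of a copy. *)
Lemma unwind_word B (k : word V) : size k <= B -> (B + B <= m)%N ->
  exists e (w : word (dtype E v m)),
    [/\ e <= B + size k, B <= e + size k,
        size w = count (fun l => l.1 != v) k
      & rcl E k * gen E v ^+ B = gen E v ^+ e * rlift th (rcl dE w)].
Proof.
move=> kB Bm; elim: k kB => [|[u b] k IH] kB.
  exists B, [::]; rewrite !addn0; split=> //.
  by rewrite rcl0 mul1g rlift1 ?mulg1 //; apply: ddata_commute.
have [e [w [e1 e2 sw ek]]] := IH (ltnW kB).
have [uv|uv] := eqVneq u v; last first.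
  exists e, ((dvert E v u (inord e), b) :: w); split.
  - by rewrite /= addnS leqW.
  - by rewrite /= addnS leqW.
  - by rewrite /= sw uv.
  have em : e < m.+1.
    rewrite ltnS; apply: leq_trans e1 _; apply: leq_trans Bm.
    by rewrite leq_add2l ltnW.
  rewrite rcl_cons -mulgA ek !rcl_cons rliftM; last exact: ddata_commute.
  rewrite !mulgA; congr (_ * _).
  have thu : rlift th (gen dE (dvert E v u (inord e))) = gen E u ^ (gen E v ^+ e).
    rewrite rlift_gen; last exact: ddata_commute.
    by rewrite ddata_dvert (negbTE uv) inordK.
  case: b {kB}; rewrite /lt /=.
    rewrite rliftV; last exact: ddata_commute.
    by rewrite thu -conjVg -conjgC.
  by rewrite thu -conjgC.
rewrite {u}uv in kB *; case: b kB => kB.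
  case: e => [|e] in e1 e2 ek *; first by move: (leq_trans kB e2); rewrite /= ltnn.
  exists e, w; split.
  - by rewrite /= addnS leqW // ltnW.
  - by rewrite /= addnS -addSn.
  - by rewrite /= eqxx.
  by rewrite rcl_cons -mulgA ek /lt /= expgS -mulgA mulKg.
exists e.+1, w; split.
- by rewrite /= addnS ltnS.
- by rewrite /= addSn addnS leqW // leqW.
- by rewrite /= eqxx.
by rewrite rcl_cons -mulgA ek /lt /= expgS mulgA.
Qed.

End Unwind.

Section InflatedDouble.
Variables (V : finType) (E : rel V) (v : V) (m n : nat) (c : 'I_n).
Hypothesis (Esym : symmetric E).

Lemma inflation_sym : symmetric (@inflation V E n).
Proof.
by move=> p q; rewrite /inflation eq_sym; case: eqP => _; [rewrite eq_sym|rewrite Esym].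
Qed.

Lemma star_inflation u j : star (@inflation V E n) (v, c) (u, j) = star E v u.
Proof.
rewrite /star /inflation /= -pair_eqE /= [v == u]eq_sym.
by case: (u == v) => //=; rewrite eq_sym orbN.
Qed.

(** The star of (v, c) contains all copies of a vertex or none. So exchanging the two indices maps
    the inflation of the double into the double of the inflation, which embeds by [ddata_emb]. *)
Lemma emb_inflated_double :
  emb (@inflation (dtype E v m) (@drel V E v m) n) (@inflation V E n).
Proof.
apply: emb_trans (ex_intro _ _ (@ddata_emb _ (@inflation V E n) (v, c) m inflation_sym)).
pose f (p : dtype E v m * 'I_n) :=
  dvert (@inflation V E n) (v, c) ((val p.1).1, p.2) (val p.1).2.
have valf p : val (f p) = ((val p.1).1, p.2, (val p.1).2).
  case: p => p j; rewrite -(dvertK p) /f /= star_inflation.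
  by case: (star E v _).
apply: (@emb_induced _ _ _ _ f).
  move=> [p j] [q l] /(congr1 val); rewrite !valf /= => -[e1 -> e2].
  by congr (_, _); apply: val_inj; rewrite [LHS]surjective_pairing e1 e2 -surjective_pairing.
move=> [p j] [q l]; rewrite /drel !valf /= !star_inflation /inflation /=.
have -> : (p == q) = (val p == val q) by rewrite (inj_eq val_inj).
case: p q => [[u i] /= pi] [[u' i'] /= pi'].
rewrite xpair_eqE /=; rewrite /dpred /= in pi pi'.
have [uu'|uu'] := eqVneq u u' => //=.
rewrite uu' in pi *; case: (boolP (star E v u')) pi pi' => /= [_ /eqP -> /eqP -> //=|_ _ _].
have [_|_] //= := eqVneq i i'.
Qed.

End InflatedDouble.

Lemma gen_conj_inj (V : choiceType) (E : rel V)
  (Esym : symmetric E) (Eirr : irreflexive E)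
  p q (g h : raag E) : gen E p ^ g = gen E q ^ h -> p = q.
Proof.
move=> e; have : gen E p ^ (g / h) = gen E q by rewrite conjgM e conjgK.
move=> /(cmin_conj_supp Esym Eirr (@cmin_gen _ E Esym Eirr p)) /(_ p).
by rewrite /= !inE eqxx => /(_ isT) /eqP.
Qed.

Lemma commute_conj_genX (V : choiceType) (E : rel V)
  (Esym : symmetric E) (Eirr : irreflexive E)
  p n (g h : raag E) : 0 < n -> commute ((gen E p ^ g) ^+ n) h <-> commute (gen E p ^ g) h.
Proof.
move=> n0; split; last by move=> c; apply/commute_sym/commuteX/commute_sym.
rewrite -conjXg => /commute_conjV /(commute_genX Esym Eirr n0) c.
exact/commute_conjV.
Qed.

Lemma conj_genX_inj (V : choiceType) (E : rel V)
  (Esym : symmetric E) (Eirr : irreflexive E)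
  p n (g h : raag E) : 0 < n -> (gen E p ^ g) ^+ n = (gen E p ^ h) ^+ n ->
  gen E p ^ g = gen E p ^ h.
Proof.
rewrite -!conjXg => n0 e.
have : commute (gen E p ^+ n) (g / h).
  by apply/commgP/conjg_fixP; rewrite conjgM e conjgK.
move=> /(commute_genX Esym Eirr n0) c.
by rewrite -[g](mulgVK h) conjgM (commute_conjg c).
Qed.

(* Separating vertices of the extension graph: repeated doubling shortens all the
   conjugating words until the family consists of vertices. *)
Lemma emb_conj_family (I V : finType) (E : rel V) (EI : rel I) n
    (k : I -> word V) (v : I -> V) (col : I -> 'I_n) :
  let c i := gen E (v i) ^ rcl E (k i) in
  symmetric E -> irreflexive E ->
  (forall i j, EI i j <-> i <> j /\ commute (c i) (c j)) ->
  (forall i j, i <> j -> c i = c j -> col i <> col j) ->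
  emb EI (@inflation V E n).
Proof.
have [N] := ubnP (\sum_i size (k i)); elim: N V E k v => // N IH V E k v kN c Esym Eirr HE Hc.
have [k0|] := boolP [forall i, k i == [::]].
  have cE i : c i = gen E (v i) by rewrite /c (eqP (forallP k0 i)) rcl0 conjg1.
  apply: (@emb_induced _ _ _ _ (fun i => (v i, col i))).
    move=> i j [vij cij]; apply/eqP; case: eqP => // ij.
    by case: (Hc i j ij); rewrite // !cE vij.
  move=> i j; rewrite /inflation /=; apply/idP/idP; last first.
    move=> /HE[ij cij]; case: eqP => [vij|/eqP vij]; last first.
      by apply: (commute_gen Esym Eirr) => //; rewrite -!cE.
    by apply/eqP; apply: Hc => //; rewrite !cE vij.
  case: eqP => [vij cij|_ vE]; apply/HE; split.
  - by move=> ij; rewrite ij eqxx in cij.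
  - by rewrite !cE vij.
  - by move=> ij; rewrite ij Eirr in vE.
  - by rewrite !cE; apply: gen_commute.
rewrite negb_forall => /existsP[i0 ki0].
have [v0 v0k] : exists v0, v0 \in unzip1 (k i0).
  by case: (k i0) ki0 => // l w _; exists l.1; rewrite mem_head.
(* B bounds all the conjugating words, and m = 2B leaves room for every exponent in
   [unwind_word]. *)
pose B := \max_i size (k i); pose m := (B + B)%N.
pose th := ygrp E \o @ddata V E v0 m; pose dE := @drel V E v0 m.
have thE a b : dE a b -> commute (th a) (th b) by apply: ddata_commute.
have unw i : exists p : nat * word (dtype E v0 m),
    [/\ p.1 <= m, size p.2 = count (fun l => l.1 != v0) (k i)
      & rcl E (k i) * gen E v0 ^+ B = gen E v0 ^+ p.1 * rlift th (rcl dE p.2)].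
  have kB : size (k i) <= B by apply: leq_bigmax.
  have [e [w [e1 _ sw ek]]] := @unwind_word V E v0 m B (k i) kB (leqnn _).
  by exists (e, w); split=> //=; apply: leq_trans e1 _; rewrite leq_add2l.
have [p Hp] := choice unw.
pose v' i := dvert E v0 (v i) (inord (p i).1 : 'I_m.+1).
pose k' i := (p i).2.
pose a i := if v i == v0 then m.+1 else 1%N.
have a_gt0 i : 0 < a i by rewrite /a; case: ifP.
pose c' i := gen dE (v' i) ^ rcl dE (k' i).
(* All images are conjugated by the same v0^B, so commutation and equality among the c' i reduce to
   those among powers of the c i. *)
have thc i : rlift th (c' i) = (c i ^+ a i) ^ (gen E v0 ^+ B).
  have [pm _ ek] := Hp i; rewrite /c' rliftJ // rlift_gen // /th ddata_dvert inordK //.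
  by rewrite -conjgM -ek conjgM /c -!conjXg.
have dsym : symmetric dE by apply: drel_sym.
have dirr : irreflexive dE by apply: drel_irr.
have th_inj (g h : raag dE) : rlift th g = rlift th h -> g = h.
  by move=> e; apply: (emb_inj (@ddata_emb V E v0 m Esym) e).
have size_k' : \sum_i size (k' i) < \sum_i size (k i).
  rewrite (bigD1 i0) //= [X in _ < X](bigD1 i0) //= -addSn leq_add //.
    have [_ sp _] := Hp i0; rewrite /k' sp -(count_predC (fun l => l.1 == v0) (k i0)).
    rewrite -[X in X < _]add0n ltn_add2r -has_count; move/mapP: v0k => [l lk ->].
    by apply/hasP; exists l.
  by apply: leq_sum => i _; have [_ sp _] := Hp i; rewrite /k' sp; apply: count_size.
apply: emb_trans (@emb_inflated_double V E v0 m n (col i0) Esym).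
apply: (IH _ _ k' v') => //.
- apply: leq_trans size_k' _; exact: kN.
- move=> i j; rewrite HE -/(c' i) -/(c' j).
  suff -> : commute (c' i) (c' j) <-> commute (c i) (c j) by [].
  have cX : commute (c i ^+ a i) (c j ^+ a j) <-> commute (c i) (c j).
    rewrite commute_conj_genX //; split=> /commute_sym H; apply: commute_sym.
      exact/(commute_conj_genX Esym Eirr (v j) (rcl E (k j)) (c i) (a_gt0 j)).
    exact/(commute_conj_genX Esym Eirr (v j) (rcl E (k j)) (c i) (a_gt0 j)).
  rewrite -cX; split=> [H|/(@conjg_commute _ _ _ (gen E v0 ^+ B)) H].
    rewrite /commute; apply: (@conjg_inj _ (gen E v0 ^+ B)).
    rewrite !(conjMg _ _ (gen E v0 ^+ B)) -!thc -!rliftM //.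
    by rewrite H.
  by apply: th_inj; rewrite (rliftM thE (c' i)) (rliftM thE (c' j)) !thc.
move=> i j ij; rewrite -/(c' i) -/(c' j) => eij; apply: (Hc i j ij).
have vij : v i = v j by have := gen_conj_inj dsym dirr eij; move=> /(congr1 val) [].
have := congr1 (rlift th) eij; rewrite !thc => /conjg_inj.
rewrite /a /c vij; apply: conj_genX_inj => //.
by case: ifP.
Qed.

(** * Decomposition into blocks *)

Section Decomposition.
Variables (V : finType) (E : rel V).
Hypotheses (Esym : symmetric E) (Eirr : irreflexive E).

Section Split.
Variables (w : word V) (Y Z : pred V).
Hypotheses (YZ : forall y z, Y y -> Z z -> E y z).
Hypotheses (cw : cmin E w) (YZw : all (fun l => Y l.1 || Z l.1) w).

Lemma rcl_split : rcl E w = rcl E (wfilter Y w) * rcl E (wfilter Z w).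
Proof. by rewrite -!retr_rcl; apply: retr_split => //; apply: par_rcl. Qed.

(** A shorter conjugate of the Y-part, retracted to Y and multiplied by the Z-part, would give a
    shorter conjugate of w. *)
Lemma cmin_split : cmin E (wfilter Y w).
Proof.
move=> u g e; pose h := retr Y g.
have e' : rcl E (wfilter Y u) = rcl E (wfilter Y w) ^ h.
  have /parP pw : par Y (rcl E (wfilter Y w)) by apply: par_rcl; apply: filter_all.
  by rewrite -retr_rcl e retrJ pw.
have chz : commute (rcl E (wfilter Z w)) h.
  apply: commute_sym; apply: (par_commute2 YZ); first exact: par_retr.
  by apply: par_rcl; apply: filter_all.
have := @cw (wfilter Y u ++ wfilter Z w) h.
rewrite rclM e' {1}rcl_split conjMg (commute_conjg chz) => /(_ erefl).
have -> : size w = (size (wfilter Y w) + size (wfilter Z w))%N.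
  rewrite !size_filter -count_predUI [X in _ = (_ + X)%N](_ : _ = 0).
    by rewrite addn0; apply/esym/eqP; rewrite -all_count.
  apply/eqP; rewrite eqn0Ngt -has_count -all_predC; apply/allP => l _ /=.
  by apply/negP => /andP[Yl Zl]; have := YZ Yl Zl; rewrite Eirr.
rewrite size_cat leq_add2r => le; apply: leq_trans le _.
by rewrite size_filter count_size.
Qed.

Lemma commute_split h : {subset Y <= unzip1 w} -> {subset Z <= unzip1 w} ->
  commute (rcl E w) h -> commute (rcl E (wfilter Y w)) h.
Proof.
move=> Yw Zw com.
have [s [l [eh ss ll]]] : exists s l,
    [/\ h = s * l, par (mem (unzip1 w)) s & par (lks E (unzip1 w)) l].
  by apply: nbs_split => //; apply: (@cmin_commute_nbs _ E Esym Eirr w 1).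
have wl u : par (mem (unzip1 w)) u -> commute u l by move=> wu; apply: lks_commute ll.
have coms : commute (rcl E w) s.
  have -> : s = h / l by rewrite eh mulgK.
  by apply: commuteM => //; apply: commuteV; apply: wl; apply: par_supp.
have pY : par Y (rcl E (wfilter Y w)) by apply: par_rcl; apply: filter_all.
rewrite eh; apply: commuteM; last by apply: wl; apply: sub_par pY.
have -> : s = retr Y s * retr Z s.
  apply: retr_split => //; apply: sub_par ss => v /mapP[k kw ->].
  exact: (allP YZw).
apply: commuteM; last by apply: (par_commute2 YZ pY); apply: par_retr.
by rewrite -retr_rcl /commute -!retrM coms.
Qed.

End Split.

Lemma irr_decomposition (w : word V) : cmin E w -> exists ws : seq (word V),
  [/\ forall u, u \in ws -> [/\ cmin E u, irr E (unzip1 u), u != [::] & {subset u <= w}],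
      rcl E w = \prod_(u <- ws) rcl E u,
      pairwise (fun u u' => allrel E (unzip1 u) (unzip1 u')) ws
    & forall h u, commute (rcl E w) h -> u \in ws -> commute (rcl E u) h].
Proof.
have [n] := ubnP (size w); elim: n w => // n IH w wn cw.
have [w0|w0] := eqVneq w [::].
  by exists [::]; split=> //; rewrite w0 big_nil.
have [iw|] := pselect (irr E (unzip1 w)).
  exists [:: w]; split=> [u||//|h u com]; rewrite ?big_seq1 // inE => /eqP -> //.
  by split.
move=> /existsNP[T /not_implyP[hT /not_implyP[hNT N]]].
pose Y := [pred v | (v \in unzip1 w) && T v]; pose Z := [pred v | (v \in unzip1 w) && ~~ T v].
have YZ y z : Y y -> Z z -> E y z.
  move=> /andP[yw Ty] /andP[zw Tz]; apply: contra_notT N => Nyz.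
  by exists y, z.
have ZY z y : Z z -> Y y -> E z y by move=> Zz Yy; rewrite Esym YZ.
have YZw : all (fun l => Y l.1 || Z l.1) w.
  by apply/allP => l lw; rewrite /= (map_f _ lw); case: (T _).
have ZYw : all (fun l => Z l.1 || Y l.1) w.
  by apply: sub_all YZw => l; rewrite orbC.
have Ysub : {subset Y <= unzip1 w} by move=> v /andP[].
have Zsub : {subset Z <= unzip1 w} by move=> v /andP[].
have szlt (A : pred V) l : l \in w -> ~~ A l.1 -> size (wfilter A w) < n.
  move=> lw Al; rewrite size_filter; apply: leq_trans (_ : size w <= n) => //.
  rewrite -(count_predC (fun l => A l.1) w) -[X in X < _]addn0 ltn_add2l -has_count.
  by apply/hasP; exists l.
move/hasP: hT => [t /mapP[l lw ->] Tt]; move/hasP: hNT => [t' /mapP[l' l'w ->] /= Tt'].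
have [||ws1 [H1 P1 W1 C1]] := IH (wfilter Y w).
- by apply: (szlt _ l') => //; rewrite /= negb_and Tt' orbT.
- exact: (cmin_split YZ).
have [||ws2 [H2 P2 W2 C2]] := IH (wfilter Z w).
- by apply: (szlt _ l) => //; rewrite /= negb_and negbK Tt orbT.
- exact: (cmin_split ZY).
exists (ws1 ++ ws2); split.
- move=> u; rewrite mem_cat => /orP[/H1|/H2] [c i z sub]; split=> // k /sub.
    by rewrite mem_filter => /andP[].
  by rewrite mem_filter => /andP[].
- by rewrite big_cat -P1 -P2 (rcl_split YZ).
- rewrite pairwise_cat W1 W2 !andbT; apply/allrelP => u u' /H1[_ _ _ s1] /H2[_ _ _ s2].
  apply/allrelP => y z /mapP[k /s1 + ->] /mapP[k' /s2 + ->].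
  by rewrite !mem_filter => /andP[Yk _] /andP[Zk' _]; apply: YZ.
- move=> h u com; rewrite mem_cat => /orP[] uw.
    by apply: (C1 h u _ uw); apply: (commute_split YZ).
  by apply: (C2 h u _ uw); apply: (commute_split ZY).
Qed.

(** The blocks are the irreducible factors of the cyclic reduction of a, conjugated back. Their
    supports are disjoint because E is irreflexive; this makes the blocks inequivalent and bounds
    their number, which leaves only finitely many types. *)
Lemma block_decomposition (a : raag E) : exists Bs : seq (block E),
  [/\ forall b, b \in Bs -> isblock b, a = \prod_(b <- Bs) blk b, size Bs <= #|V|,
      forall h b, commute a h -> b \in Bs -> commute (blk b) h
    & pairwise (fun b c => `[< ~ bsim b c /\ ~ bsim c b >]) Bs].
Proof.
have [w [k [-> cw]]] := cmin_exists a.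
have [ws [H P W C]] := irr_decomposition cw.
have memAll (u u' : word V) y : allrel E (unzip1 u) (unzip1 u') ->
    y \in unzip1 u -> y \notin unzip1 u'.
  by move=> /allrelP A yu; apply/negP => yu'; have := A y y yu yu'; rewrite Eirr.
exists [seq (u, k) | u <- ws]; split.
- by move=> _ /mapP[u /H[c i z _] ->].
- rewrite big_map P; elim: (ws) => [|u us IH]; first by rewrite !big_nil conj1g.
  by rewrite !big_cons conjMg IH.
- rewrite size_map.
  have [x0 _|V0] := pickP (fun _ : V => true); last first.
    case: ws => // u us in H W P C *.
    by have [_ _] := H u (mem_head _ _); case: u {H W P C} => // l; have := V0 l.1.
  pose f (u : word V) := head x0 (unzip1 u).
  have fin u : u \in ws -> f u \in unzip1 u.
    by move=> /H[_ _]; rewrite /f; case: u => // l u _ _; rewrite mem_head.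
  suff : uniq (map f ws).
    by move=> /card_uniqP; rewrite size_map => <-; apply: max_card.
  elim: ws W fin {H P C} => //= u us IH /andP[A W] fin.
  rewrite IH ?andbT //; last by move=> u' u'us; apply: fin; rewrite inE u'us orbT.
  apply/negP => /mapP[u' u'us e]; have := memAll _ _ _ (allP A _ u'us) (fin u (mem_head _ _)).
  by rewrite e fin // inE u'us orbT.
- move=> h _ com /mapP[u uws ->]; apply/commute_conjV; apply: C uws.
  exact/commute_conjV.
- rewrite pairwise_map; have nz u : u \in ws -> exists y, y \in unzip1 u.
    by move=> /H[_ _]; case: u => // l u _ _; exists l.1; rewrite mem_head.
  have H' u : u \in ws -> cmin E u by move=> /H[].
  have N u u' : u \in ws -> u' \in ws -> (forall y, y \in unzip1 u -> y \notin unzip1 u') ->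
      ~ bsim ((u, k) : block E) (u', k).
    move=> uw u'w D [same _]; have [y yu] := nz u uw.
    have : inP ((u, k) : block E) (gen E y ^ k) by rewrite /inP /= conjgK par_gen.
    rewrite same /inP /= conjgK => /(geod_par (cmin_geod (@cmin_gen _ E Esym Eirr y))) /=.
    by rewrite andbT (negbTE (D y yu)).
  elim: ws W nz H' N {H P C} => //= u us IH /andP[A W] nz H' N.
  rewrite IH // ?andbT; first last.
  - by move=> u1 u2 u1s u2s; apply: N; rewrite inE ?u1s ?u2s orbT.
  - by move=> u1 u1s; apply: H'; rewrite inE u1s orbT.
  - by move=> u1 u1s; apply: nz; rewrite inE u1s orbT.
  apply/allP => u' u'us /=; apply/asboolP; have D := memAll _ _ _ (allP A _ u'us).
  split; apply: N; rewrite ?inE ?eqxx ?u'us ?orbT // => y yu'.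
  by apply/negP => /D; rewrite yu'.
Qed.

End Decomposition.

Lemma rcl_extend (V V' : choiceType) (E' : rel V') (f : V -> word V') u :
  rcl E' (extend f u) = ev (fun x => rcl E' (f x)) u.
Proof.
elim: u => [|[x b] u IH]; first by rewrite /ev big_nil.
by rewrite ev_cons -IH /extend /= rclM; case: b; rewrite //= rclV.
Qed.

Lemma ev_extend (V V' : choiceType) (H : groupType) (f : V -> word V') (y : V' -> H) u :
  ev y (extend f u) = ev (fun x => ev y (f x)) u.
Proof.
elim: u => [|[x b] u IH]; first by rewrite /ev !big_nil.
by rewrite ev_cons -IH /extend /= ev_cat; case: b; rewrite //= ev_winv.
Qed.

(** * Existential sentences and types *)

Section Sentence.
Variables (X : finType).

Definition word_term (u : word X) : gterm :=
  foldr (fun l t => TMul (if l.2 then TInv (TVar (enum_rank l.1))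
    else TVar (enum_rank l.1)) t) TOne u.

Lemma teval_word_term (V : eqType) (env : nat -> word V) u :
  teval env (word_term u) = extend (fun x => env (enum_rank x)) u.
Proof. by elim: u => [|[x b] u IH] //=; rewrite IH /extend /=; case: b. Qed.

Definition conj_formula (A : eqType) (F : A -> qformula) (s : seq A) : qformula :=
  foldr (fun a f => QAnd (F a) f) QTrue s.

Lemma qsat_conj (V : eqType) (E : rel V) env (A : eqType) (F : A -> qformula) s :
  qsat E env (conj_formula F s) <-> forall a, a \in s -> qsat E env (F a).
Proof.
elim: s => [|a s IH] /=; first by split.
split=> [[Fa /IH Fs] b|H]; first by rewrite inE => /predU1P[->|/Fs].
split; first by apply: H; rewrite mem_head.
by apply/IH => b bs; apply: H; rewrite inE bs orbT.
Qed.

Definition gen_env (i : nat) : word X :=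
  if [pick x | enum_rank x == i :> nat] is Some x then [:: (x, false)] else [::].

Lemma gen_envE x : gen_env (enum_rank x) = [:: (x, false)].
Proof.
rewrite /gen_env; case: pickP => [y /eqP/val_inj/enum_rank_inj -> //|/(_ x)].
by rewrite eqxx.
Qed.

Lemma extend_gen_env u : extend (fun x => gen_env (enum_rank x)) u = u.
Proof.
elim: u => [|[x b] u IH] //; rewrite /extend /= in IH *.
by rewrite IH gen_envE; case: b.
Qed.

End Sentence.

(** An existential sentence can say that a tuple satisfies the commutation relations and violates
    finitely many equations. The generators of G(ED) satisfy it, and a solution in G(E) is psi. *)
Lemma discriminating_hom (VD : finType) (ED : rel VD) (V : eqType) (E : rel V)
    (A : finType) (p : A -> word VD * word VD) : th_ex_sub ED E ->
  exists psi : VD -> word V,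
    (forall x y, ED x y -> raag_eq E (psi x ++ psi y) (psi y ++ psi x)) /\
    forall a, ~ raag_eq ED (p a).1 (p a).2 ->
      ~ raag_eq E (extend psi (p a).1) (extend psi (p a).2).
Proof.
move=> sub.
pose Fc (q : VD * VD) := QEq (word_term [:: (q.1, false); (q.2, false)])
  (word_term [:: (q.2, false); (q.1, false)]).
pose Fn (a : A) := QNot (QEq (word_term (p a).1) (word_term (p a).2)).
pose f := QAnd (conj_formula Fc [seq q <- enum {: VD * VD} | ED q.1 q.2])
  (conj_formula Fn [seq a <- enum A | `[< ~ raag_eq ED (p a).1 (p a).2 >]]).
have [|env [/qsat_conj C /qsat_conj N]] := sub f.
  exists (@gen_env VD); split; apply/qsat_conj => q; rewrite mem_filter => /andP[H _].
    rewrite /Fc; cbn [qsat]; rewrite !teval_word_term !extend_gen_env.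
    by have := @re_step _ ED [::] _ _ [::] (rs_comm H).
  by rewrite /Fn; cbn [qsat]; rewrite !teval_word_term !extend_gen_env; apply/asboolP.
exists (fun x => env (enum_rank x)); split=> [x y xy|a Na].
  have := C (x, y); rewrite mem_filter mem_enum andbT => /(_ xy).
  by rewrite /Fc; cbn [qsat]; rewrite !teval_word_term /extend /= !cats0.
have := N a; rewrite mem_filter mem_enum andbT => /(_ (asboolT Na)).
by rewrite /Fn; cbn [qsat]; rewrite !teval_word_term.
Qed.

(* A type: which of the blocks (x, j) occur, and which of them commute. *)
Section Types.
Variables (VD : finType) (M : nat).
Definition btype := ({set VD * 'I_M} * {set (VD * 'I_M) * (VD * 'I_M)})%type.
Variable t : btype.
Definition bvert := {p : VD * 'I_M | p \in t.1}.
HB.instance Definition _ := Finite.on bvert.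
Definition brel : rel bvert := fun p q => (val p, val q) \in t.2.
Definition bverts (x : VD) : seq bvert := pmap (fun j => insub (x, j)) (enum 'I_M).
Definition bmap (x : VD) : word bvert := [seq (p, false) | p <- bverts x].

Lemma mem_bverts x p : p \in bverts x -> (val p).1 = x.
Proof.
rewrite mem_pmap => /mapP[j _ e]; have := esym e; case: insubP => //= q _ vq [<-].
by rewrite vq.
Qed.

Lemma uniq_bverts x : uniq (bverts x).
Proof.
apply: (@pmap_uniq _ _ _ (fun p : bvert => (val p).2)); last exact: enum_uniq.
by move=> j; case: insubP => //= p _ ->.
Qed.

End Types.

(** * Construction of the tame embedding *)

Theorem theorem4p12 (VD : finType) (ED : rel VD) (VG : finType) (EG : rel VG) :
  simplicial_graph ED -> simplicial_graph EG ->
  th_ex_sub ED EG ->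
  exists phi : VD -> word (VG * 'I_#|VD|)%type,
    @tame_embedding VD ED _ (@inflation VG EG #|VD|) phi.
Proof.
move=> [Dsym Dirr] [Gsym Girr] sub.
pose M := #|VG|; pose T := btype VD M.
(* A pair of distinct elements identified by the map of type t, if there is one; otherwise a pair of
   empty words, on which nothing is required. *)
have wit (t : T) : exists p : word VD * word VD,
    (exists q : word VD * word VD,
      raag_eq (@brel _ _ t) (extend (bmap t) q.1) (extend (bmap t) q.2) /\
      ~ raag_eq ED q.1 q.2) ->
    raag_eq (@brel _ _ t) (extend (bmap t) p.1) (extend (bmap t) p.2) /\ ~ raag_eq ED p.1 p.2.
  have [[q Hq]|N] := pselect (exists q : word VD * word VD,
      raag_eq (@brel _ _ t) (extend (bmap t) q.1) (extend (bmap t) q.2) /\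
      ~ raag_eq ED q.1 q.2); first by exists q.
  by exists ([::], [::]).
have [p Hp] := choice wit.
have [psi [psiE psiN]] := discriminating_hom p sub.
pose a x := rcl EG (psi x).
have aE x y : ED x y -> commute (a x) (a y).
  by move=> xy; rewrite /commute /a -!rclM; apply/rclP/psiE.
have [Bs HBs] := choice (fun x => block_decomposition Gsym Girr (a x)).
pose b0 : block EG := ([::], 1); pose B (q : VD * 'I_M) := nth b0 (Bs q.1) q.2.
(* The type realized by [psi]. Its first component keeps only the indices at which [B] does not fall
   back on the default [b0]. *)
pose t : T := ([set q : VD * 'I_M | q.2 < size (Bs q.1)],
  [set qq : (VD * 'I_M) * (VD * 'I_M) |
    (qq.1 != qq.2) && `[< commute (blk (B qq.1)) (blk (B qq.2)) >]]).
pose I := bvert t; pose EI := @brel _ _ t.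
have inBs (i : I) : B (val i) \in Bs (val i).1.
  by case: i => q /= qt; apply: mem_nth; move: qt; rewrite inE.
have EIP (i j : I) : reflect (i <> j /\ commute (blk (B (val i))) (blk (B (val j)))) (EI i j).
  rewrite /EI /brel inE /= (inj_eq val_inj).
  apply: (iffP andP) => [[/eqP ij /asboolP c]|[ij c]]; split=> //; first exact/eqP.
  exact/asboolP.
have EIsym : symmetric EI.
  move=> i j; apply/EIP/EIP => -[ij c]; split;
    by [apply/nesym | apply/commute_sym].
have EIirr : irreflexive EI by move=> i; apply/EIP => -[].
pose y (i : I) := blk (B (val i)).
have yE i j : EI i j -> commute (y i) (y j) by move=> /EIP[].
have evy x : ev y (bmap t x) = a x.
  have [_ -> szB _ _] := HBs x; rewrite /ev /bmap big_map /= /bverts.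
  have -> : forall s, \prod_(i <- pmap (fun j : 'I_M => insub (x, j) : option I) s) y i =
      \prod_(j <- s | j < size (Bs x)) blk (B (x, j)).
    elim=> [|j s IH]; first by rewrite !big_nil.
    rewrite big_cons /=; case: insubP => [i it iv|it] /=.
      rewrite big_cons IH; move: it; rewrite inE /= => ->.
      by rewrite /y iv.
    by rewrite IH; move: it; rewrite inE /= => /negbTE ->.
  rewrite (big_nth b0) (big_nat_widen _ _ M) // /index_iota subn0 -val_enum_ord big_map.
  by apply: eq_bigl.
(* If the map of type t were not injective, it would identify the pair [p t]; so would [psi], which
   factors through it by [evy], against the choice of [psi]. *)
have f_inj u w : raag_eq EI (extend (bmap t) u) (extend (bmap t) w) -> raag_eq ED u w.
  move=> e; apply: contrapT => Nuw; have [|e' N'] := Hp t; first by exists (u, w).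
  apply: (psiN t N'); apply/rclP; rewrite !rcl_extend -/a.
  have := ev_raag_eq yE e'; rewrite !ev_extend.
  by rewrite !(eq_ev evy).
have blkI (i : I) : isblock (B (val i)).
  by have [H _ _ _ _] := HBs (val i).1; apply: H.
have crossE x x' i i' : ED x x' -> i \in bverts t x -> i' \in bverts t x' -> EI i i'.
  move=> xx' /mem_bverts ix /mem_bverts ix'; apply/EIP; split.
    by move=> ii'; rewrite -ix -ix' ii' Dirr in xx'.
  have [_ _ _ Cx _] := HBs x; have [_ _ _ Cx' _] := HBs x'.
  apply: Cx; last by rewrite -ix.
  apply: commute_sym; apply: Cx'; last by rewrite -ix'.
  exact/commute_sym/aE.
have sameE x i i' : i \in bverts t x -> i' \in bverts t x -> i <> i' ->
    EI i i' /\ ~ bsim (B (val i)) (B (val i')).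
  move=> /mem_bverts ix /mem_bverts ix' ii'; have [_ _ _ Cx Px] := HBs x.
  split.
    apply/EIP; split=> //; apply: (Cx); last by rewrite -ix.
    apply: commute_sym; apply: Cx; last by rewrite -ix'.
    exact: commute_refl.
  have N : (val i).2 != (val i').2.
    apply/eqP => e; apply: ii'; apply: val_inj.
    by rewrite [LHS]surjective_pairing ix -ix' e -surjective_pairing.
  have lt (l : I) : (val l).1 = x -> (val l).2 < size (Bs x).
    by case: l => l /= lt <-; move: lt; rewrite inE.
  move: N; rewrite -val_eqE neq_ltn /B ix ix' => /orP[] N.
    by have /asboolP[] := pairwiseP b0 Px _ _ (lt _ ix) (lt _ ix') N.
  by have /asboolP[] := pairwiseP b0 Px _ _ (lt _ ix') (lt _ ix) N.
have [v [k [Hsim Hneq Hcom]]] := vertex_system Gsym Girr blkI.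
(* The colour of a block is the vertex x of ED that it comes from. Equivalent blocks share one
   vertex conjugate, but by [sameE] distinct ones come from different x, so #|VD| colours
   suffice. *)
have [d Hd] : emb EI (@inflation VG EG #|VD|).
  apply: (@emb_conj_family I VG EG EI #|VD| (fun i => rword (k i)) v
    (fun i => enum_rank (val i).1)) => // i j; rewrite !rwordK.
    split=> [/EIP[ij cij]|[ij cij]]; last apply/EIP; split=> //.
      have [s|s] := pselect (bsim (B (val i)) (B (val j))); last exact/Hcom.
      by have [-> ->] := Hsim _ _ s.
    have [[] //|s] := pselect (bsim (B (val i)) (B (val j))).
    exact/Hcom.
  move=> ij cij /enum_rank_inj xij.
  have [s|/Hneq[]//] := pselect (bsim (B (val i)) (B (val j))).
  have mb (l : I) : l \in bverts t (val l).1.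
    rewrite mem_pmap; apply/mapP; exists (val l).2; rewrite ?mem_enum //.
    by rewrite -surjective_pairing valK.
  by have [] := @sameE (val i).1 i j (mb i) _ ij; rewrite // xij.
have [d_gt0 dE d_inj] := Hd.
pose EL := @inflation VG EG #|VD|.
pose yg := ygrp EL \o d.
pose dd (i : I) : (word (VG * 'I_#|VD|)%type * (VG * 'I_#|VD|) * int)%type :=
  ((d i).1, Posz (d i).2).
have rcl_dd i : rcl EL (yword (dd i)) = yg i.
  rewrite /yword /dd /yg /= /ygrp /conjw /wpow /= !rclM rclV /conjg.
  by congr (_ * (_ * _)); apply: rcl_nseq.
pose dat x := [seq dd i | i <- bverts t x].
pose phi x := flatten [seq yword e | e <- dat x].
have rcl_phi x : rcl EL (phi x) = ev yg (bmap t x).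
  rewrite /phi /dat /bmap; elim: (bverts t x) => [|i s IH]; first by rewrite /ev big_nil.
  by rewrite /= rclM IH rcl_dd ev_cons.
have tnth_dat x (j : 'I_(size (dat x))) :
    exists i, [/\ i \in bverts t x, tnth (in_tuple (dat x)) j = dd i
      & index i (bverts t x) = j].
  have sz : size (dat x) = size (bverts t x) by rewrite size_map.
  pose i := tnth (in_tuple (bverts t x)) (cast_ord sz j).
  have iE : i = nth i (bverts t x) j by rewrite {1}/i (tnth_nth i).
  exists i; split; first exact: mem_tnth.
    by rewrite (tnth_nth (dd i)) /= (nth_map i) -?sz // -iE.
  by rewrite iE index_uniq ?uniq_bverts // -sz.
exists phi; split.
- move=> x x' xx'; apply/rclP; rewrite !rclM !rcl_phi.
  have -> : forall u w, ev yg u * ev yg w = ev yg (u ++ w) by move=> u w; rewrite ev_cat.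
  rewrite -ev_cat; apply: (ev_raag_eq dE); apply/rclP; rewrite !rclM.
  apply: rcl_commute => _ /mapP[i ix ->] /=; apply: commute_sym.
  apply: rcl_commute => _ /mapP[i' ix' ->] /=; apply/commute_sym/gen_commute.
  exact: crossE xx' ix ix'.
- move=> u w /rclP; rewrite !rcl_extend !(eq_ev rcl_phi) -!ev_extend => /d_inj.
  by move=> /rclP/f_inj.
exists dat; split.
- by move=> x; apply: re_refl.
- move=> x j1 j2; have [i1 [m1 -> _]] := tnth_dat x j1; have [i2 [m2 -> _]] := tnth_dat x j2.
  have [->|/eqP i12] := eqVneq i1 i2; first exact: re_refl.
  apply/rclP; rewrite !(rclM _ (yword _) (yword _)) !rcl_dd; apply: dE.
  by have [] := sameE _ _ _ m1 m2 i12.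
- move=> x1 x2 j1 j2 ne; have [i1 [m1 -> e1]] := tnth_dat x1 j1.
  have [i2 [m2 -> e2]] := tnth_dat x2 j2.
  have i12 : i1 != i2.
    apply/eqP => i12; case: ne => [[]|[]].
      by rewrite -(mem_bverts m1) -(mem_bverts m2) i12.
    have x12 : x1 = x2 by rewrite -(mem_bverts m1) -(mem_bverts m2) i12.
    by rewrite -e1 -e2 i12 x12.
  move=> /rclP; rewrite /cword /conjw !rclM !rclV /= => ce.
  have ygE i : yg i =
      ((rcl EL (d i).1.1)^-1 * (gen EL (d i).1.2 * rcl EL (d i).1.1)) ^+ (d i).2.
    by rewrite /yg /= /ygrp conjXg.
  (* If the two conjugates were equal, powers of the images of i1 and i2 would agree. By injectivity
     so would powers of the generators i1 and i2, and the retraction onto i1 would make a positive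
     power of i1 trivial. *)
  have : ev yg (nseq (d i2).2 (i1, false)) = ev yg (nseq (d i1).2 (i2, false)).
    have evn n i : ev yg (nseq n (i, false)) = yg i ^+ n.
      by elim: n => [|n IH]; [rewrite /ev big_nil | rewrite expgS -IH /= ev_cons].
    by rewrite !evn !ygE -!expgnA mulnC ce.
  move=> /d_inj /(congr1 (retr (pred1 i1))); rewrite !retr_rcl /wfilter.
  rewrite (eq_in_filter (a2 := predT)); last by move=> l /nseqP[-> _] /=; rewrite eqxx.
  rewrite [X in _ = rcl _ X](eq_in_filter (a2 := pred0)); last first.
    by move=> l /nseqP[-> _] /=; rewrite eq_sym (negbTE i12).
  rewrite filter_predT filter_pred0 rcl0.
  exact: (gen_exp_neq1 EIsym EIirr).
Qed.
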